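(* Let $\Omega\subset\mathbb{R}^d$ be a measurable set that $k$-tiles $\mathbb{R}^d$ by translations of the full lattice $\Lambda$, for some $k\ge 1$, and suppose that the set $\Lambda_\Omega(J)$ is $(\alpha,\delta)$-separated for some $\alpha\in\mathbb{R}^d$, some $\delta>0$, and some full measure subset $J\subseteq I$. Then $L^2(\Omega)$ admits a structured Riesz basis of exponentials.
   Context: $\Lambda=M\mathbb{Z}^d\subset\mathbb{R}^d$, $M\in GL_d(\mathbb{R})$, is a full lattice; $I=M([-\frac12,\frac12)^d)$ is its fundamental domain; $H=\{h\in\mathbb{R}^d:\langle h,\lambda\rangle\in\mathbb{Z}\ \text{for all }\lambda\in\Lambda\}$ is its dual lattice. Write $e_a(x)=e^{2\pi i a\cdot x}$ for $a,x\in\mathbb{R}^d$. A measurable set $\Omega\subset\mathbb{R}^d$ $k$-tiles $\mathbb{R}^d$ by translations of $\Lambda$ if $\sum_{\lambda\in\Lambda}\chi_\Omega(\omega-\lambda)=k$ for a.e. $\omega\in\mathbb{R}^d$; it is then called a multi-tiling set. In this case $\Lambda_\omega=\{\lambda\in\Lambda:\lambda+\omega\in\Omega\}$ has exactly $k$ elements for a.e. $\omega\in I$; for simplicity it is assumed that this holds for every $\omega\in I$. Listing the elements of $\Lambda_\omega$ in lexicographic order of $\mathbb{R}^d$ gives the vector $\vec\lambda(\omega)=(\lambda_1(\omega),\dots,\lambda_k(\omega))\in(\mathbb{R}^d)^k$. For $J\subseteq I$, $\Lambda_\Omega(J)=\{\vec\lambda(\omega):\omega\in J\}$. A full measure subset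 $J\subseteq I$ is a measurable set with $|I\setminus J|=0$. Given $\alpha\in\mathbb{R}^d$ and $\delta>0$, a set $\Gamma\subseteq(\mathbb{R}^d)^k$ is $(\alpha,\delta)$-separated if $|e^{2\pi i\alpha\cdot\gamma_j}-e^{2\pi i\alpha\cdot\gamma_\ell}|\ge\delta$ for every $\vec\gamma=(\gamma_1,\dots,\gamma_k)\in\Gamma$ and all $j\ne\ell$. For a $k$-tiling set $\Omega$, $L^2(\Omega)$ admits a structured Riesz basis of exponentials if there exist $a_1,\dots,a_k\in\mathbb{R}^d$ such that $\{e_{a_j+h}\}_{h\in H,\,1\le j\le k}$ is a Riesz basis of $L^2(\Omega)$, i.e. it is complete in $L^2(\Omega)$ and there are constants $A,B>0$ such that, for all $\{c_{j,h}\}\in\ell^2(\{1,\dots,k\}\times H)$, $A\sum_{j,h}|c_{j,h}|^2\le\|\sum_{j,h}c_{j,h}e_{a_j+h}\|_{L^2(\Omega)}^2\le B\sum_{j,h}|c_{j,h}|^2$. *)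

(* Defs.v *)
From HB Require Import structures.
From mathcomp Require Import all_boot all_order all_algebra.
From mathcomp Require Import all_classical all_reals all_analysis.
From mathcomp Require Import complex.

Set Implicit Arguments.
Unset Strict Implicit.
Unset Printing Implicit Defensive.
Import Order.TTheory GRing.Theory Num.Theory.
Import numFieldNormedType.Exports.

Local Open Scope classical_set_scope.
Local Open Scope ring_scope.

Section borel_cV.
Variables (R : realType) (d : nat).

Definition cV_coord (i : 'I_d) (x : 'cV[R]_d) : measurableTypeR R := x i ord0.

Let cV_set0 : g_sigma_preimage cV_coord set0.
Proof. exact: sigma_algebra0. Qed.

Let cV_setC A : g_sigma_preimage cV_coord A ->
  g_sigma_preimage cV_coord (~` A).
Proof. exact: sigma_algebraC. Qed.

Let cV_bigcup (F : _^nat) : (forall i, g_sigma_preimage cV_coord (F i)) ->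
  g_sigma_preimage cV_coord (\bigcup_i (F i)).
Proof. exact: sigma_algebra_bigcup. Qed.

(* The product (i.e. Borel) sigma-algebra of R^d. *)
HB.instance Definition _ := @isMeasurable.Build default_measure_display
  'cV[R]_d (g_sigma_preimage cV_coord) cV_set0 cV_setC cV_bigcup.

End borel_cV.

Section cV_cons.
Context {R : realType}.

Lemma measurable_cV_coord n (i : 'I_n) :
  measurable_fun setT (@cV_coord R n i).
Proof.
move=> _ Y mY; rewrite setTI; apply: sub_sigma_algebra => /=.
rewrite -bigcup_seq/=; exists i => /=; first by rewrite mem_index_enum.
by exists Y => //; rewrite setTI.
Qed.

Lemma measurable_fun_cV d (T : measurableType d) n (f : T -> 'cV[R]_n) :
  (forall i, measurable_fun setT (cV_coord i \o f)) -> measurable_fun setT f.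
Proof.
move=> mf; apply: (@measurability _ _ _ _ _ _
  (\big[setU/set0]_(i < n) preimage_set_system setT (@cV_coord R n i)
    measurable)) => // _ [B + <-].
rewrite -bigcup_seq => -[i _ [C mC <-]].
by rewrite !setTI -comp_preimage -[X in measurable X]setTI; exact: mf.
Qed.

Context {d : nat}.

Definition cV_cons (p : measurableTypeR R * 'cV[R]_d) : 'cV[R]_d.+1 :=
  col_mx (p.1)%:M p.2.

Definition cV_uncons (x : 'cV[R]_d.+1) : measurableTypeR R * 'cV[R]_d :=
  (x ord0 ord0, dsubmx (x : 'cV[R]_(1 + d))).

Lemma cV_consK : cancel cV_cons cV_uncons.
Proof.
move=> [x y]; rewrite /cV_uncons /cV_cons [X in (_, X)]col_mxKd /=; congr pair.
rewrite (_ : ord0 = lshift d (ord0 : 'I_1)) ?(@col_mxEu _ 1).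
  by rewrite mxE mulr1n.
exact: val_inj.
Qed.

Lemma measurable_cV_cons : measurable_fun setT cV_cons.
Proof.
apply: measurable_fun_cV => i.
case: (split_ordP (i : 'I_(1 + d))) => j ij.
  rewrite (_ : _ \o _ = fst); first exact: measurable_fst.
  apply/funext => -[x y] /=; rewrite /cV_coord /cV_cons ij.
  by rewrite (@col_mxEu _ 1) !ord1 mxE eqxx mulr1n.
rewrite (_ : _ \o _ = cV_coord j \o snd).
  by apply: measurableT_comp; [exact: measurable_cV_coord|].
apply/funext => -[x y] /=; rewrite /cV_coord /cV_cons ij.
by rewrite (@col_mxEd _ 1).
Qed.

Lemma measurable_cV_uncons : measurable_fun setT cV_uncons.
Proof.
apply/measurable_fun_pairP; split; first exact: (measurable_cV_coord ord0).
apply: measurable_fun_cV => i.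
rewrite (_ : _ \o _ = cV_coord (rshift 1 i : 'I_d.+1)).
  exact: measurable_cV_coord.
by apply/funext => x /=; rewrite /cV_coord mxE.
Qed.

End cV_cons.

Section lebesgue_cons.
Local Open Scope ereal_scope.
Context {R : realType} {d : nat}.
Variable m : {sigma_finite_measure set 'cV[R]_d -> \bar R}.

Definition lebesgue_cons : set 'cV[R]_d.+1 -> \bar R :=
  pushforward (@lebesgue_measure R \x m) cV_cons.

Let cons0 : lebesgue_cons set0 = 0.
Proof. by rewrite /lebesgue_cons /pushforward preimage_set0 measure0. Qed.

Let cons_ge0 A : 0 <= lebesgue_cons A.
Proof. exact: (measure_ge0 (@lebesgue_measure R \x m)). Qed.

Let cons_semi_sigma_additive : semi_sigma_additive lebesgue_cons.
Proof.
move=> F mF tF _; have mG n : measurable (cV_cons @^-1` F n).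
  by rewrite -[X in measurable X]setTI; exact: measurable_cV_cons.
rewrite /lebesgue_cons /pushforward preimage_bigcup.
apply: measure_semi_sigma_additive => //; last exact: bigcup_measurable.
apply/trivIsetP => /= i j _ _ ij; rewrite -preimage_setI.
by move/trivIsetP : tF => /(_ _ _ _ _ ij) ->//; rewrite preimage_set0.
Qed.

HB.instance Definition _ := isMeasure.Build _ _ _ lebesgue_cons
  cons0 cons_ge0 cons_semi_sigma_additive.

Let cons_sigma_finite : sigma_finite setT lebesgue_cons.
Proof.
have /sigma_finiteP[F [TF ndF Foo]] := sigma_finiteT (@lebesgue_measure R).
have /sigma_finiteP[G [TG ndG Goo]] := sigma_finiteT m.
exists (fun n => cV_uncons @^-1` (F n `*` G n)) => [|n].
  rewrite -preimage_bigcup (_ : \bigcup_n _ = setT) ?preimage_setT//.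
  apply/seteqP; split=> // -[x y] _.
  have [i _ Fx] : (\bigcup_n F n) x by rewrite -TF.
  have [j _ Gy] : (\bigcup_n G n) y by rewrite -TG.
  exists (maxn i j) => //; split => /=.
  - by move: x Fx; exact/subsetPset/ndF/leq_maxl.
  - by move: y Gy; exact/subsetPset/ndG/leq_maxr.
have [mF Fn] := Foo n; have [mG Gn] := Goo n; split.
  rewrite -[X in measurable X]setTI; apply: measurable_cV_uncons => //.
  exact: measurableX.
rewrite /lebesgue_cons /pushforward -comp_preimage.
rewrite (_ : _ \o _ = id) ?preimage_id; last first.
  by apply/funext => p; exact: cV_consK.
by rewrite product_measure1E// lte_mul_pinfty// ge0_fin_numE.
Qed.

HB.instance Definition _ := Measure_isSigmaFinite.Build _ _ _ lebesgue_cons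
  cons_sigma_finite.

End lebesgue_cons.

(* d-fold product of the one-dimensional Lebesgue measure, on Borel sets. *)
Fixpoint borel_lebesgue (R : realType) (d : nat) :
    {sigma_finite_measure set 'cV[R]_d -> \bar R} :=
  match d with
  | 0 => \d_(0 : 'cV[R]_0)
  | d'.+1 => lebesgue_cons (borel_lebesgue R d')
  end.

(* The measurable space of Lebesgue (not only Borel) measurable subsets of R^d;
   the underlying type is 'cV[R]_d. *)
Definition lebesgue_space (R : realType) (d : nat) :=
  caratheodory_type ((borel_lebesgue R d)^*)%mu.
HB.instance Definition _ (R : realType) (d : nat) :=
  Measurable.on (@lebesgue_space R d).

Definition lebesgue (R : realType) (d : nat) :
    {measure set (lebesgue_space R d) -> \bar R} :=
  @completed_measure_extension _ _ R (borel_lebesgue R d).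

Definition lebesgue_measurable (R : realType) (d : nat) (A : set 'cV[R]_d) :=
  measurable (A : set (lebesgue_space R d)).

Section lattice.
Variables (R : realType) (d : nat).
Implicit Types (M : 'M[R]_d) (a x y w : 'cV[R]_d) (Omega J : set 'cV[R]_d).

Definition dot a x : R := \sum_(i < d) a i ord0 * x i ord0.

Definition lattice M : set 'cV[R]_d :=
  [set M *m map_mx intr z | z in [set: 'cV[int]_d]].

Definition fundamental_domain M : set 'cV[R]_d :=
  [set M *m x | x in [set x : 'cV[R]_d | forall i, - 2^-1 <= x i ord0 < 2^-1]].

Definition dual_lattice M : set 'cV[R]_d :=
  [set h | forall l, lattice M l -> dot h l \is a Num.int].

(* e^(2 pi i a.x), by Euler's formula. *)
Definition expo a x : R[i] :=
  (cos (2 * pi * dot a x) +i* sin (2 * pi * dot a x))%C.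

Definition k_tiles (k : nat) M Omega :=
  {ae lebesgue R d, forall w,
    \esum_(l in lattice M) (\1_Omega (w - l))%:E = k%:R%:E :> \bar R}.

Definition lattice_fiber M Omega w : set 'cV[R]_d :=
  [set l | lattice M l /\ Omega (l + w)].

Definition lex_lt x y : Prop :=
  exists i : 'I_d, (forall j : 'I_d, (j < i)%N -> x j ord0 = y j ord0) /\
    x i ord0 < y i ord0.

Definition lex_listing (k : nat) (A : set 'cV[R]_d) (g : 'I_k -> 'cV[R]_d) :=
  range g = A /\ forall j l : 'I_k, (j < l)%N -> lex_lt (g j) (g l).

(* A listing, when it exists, is unique: it is the vector of lattice points
   attached to w.  It exists exactly when the fiber over w has k elements. *)
Definition fiber_vectors (k : nat) M Omega J : set ('I_k -> 'cV[R]_d) :=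
  [set g | exists2 w, J w & lex_listing (lattice_fiber M Omega w) g].

Definition full_measure_subset J (I : set 'cV[R]_d) :=
  [/\ lebesgue_measurable J, J `<=` I & lebesgue R d (I `\` J) = 0%E].

Definition exp_separated (k : nat) a (delta : R) (G : set ('I_k -> 'cV[R]_d)) :=
  forall g, G g -> forall j l : 'I_k, j != l ->
    delta <= Normc.normc (expo a (g j) - expo a (g l)).

End lattice.

Arguments fiber_vectors {R d} k M Omega J _.

Section riesz_basis.
Variables (R : realType) (d : nat) (Omega : set 'cV[R]_d).
Implicit Types f g : 'cV[R]_d -> R[i].

Definition L2_sqnorm f : \bar R :=
  (\int[lebesgue R d]_(x in Omega) (Normc.normc (f x) ^+ 2)%:E)%E.

Definition in_L2 f :=
  [/\ measurable_fun (Omega : set (lebesgue_space R d))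
        (fun x => complex.Re (f x)),
      measurable_fun (Omega : set (lebesgue_space R d))
        (fun x => complex.Im (f x)) &
      (L2_sqnorm f < +oo)%E].

Variables (K : choiceType) (S : set K).
Implicit Types (u : K -> 'cV[R]_d -> R[i]) (c : K -> R[i]).

Definition L2_complete u := forall f, in_L2 f -> forall eps : R, 0 < eps ->
  exists (F : set K) c, fsets S F /\
    (L2_sqnorm (fun x => f x - \sum_(s \in F) c s * u s x)%R < (eps ^+ 2)%:E)%E.

(* Unconditional convergence: limit along the finite subsets of S. *)
Definition L2_sum u g := forall eps : R, 0 < eps ->
  exists2 F0, fsets S F0 & forall F, fsets S F -> F0 `<=` F ->
    (L2_sqnorm (fun x => \sum_(s \in F) u s x - g x)%R < (eps ^+ 2)%:E)%E.

Definition l2_sqnorm c : \bar R :=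
  \esum_(s in S) (Normc.normc (c s) ^+ 2)%:E.

(* The series of an l^2 family is required to converge in L^2(Omega); its sum g,
   unique up to a null set, carries the two bounds. *)
Definition riesz_basis u :=
  [/\ forall s, S s -> in_L2 (u s),
      L2_complete u &
      exists A B : R, [/\ 0 < A, 0 < B &
        forall c, (l2_sqnorm c < +oo)%E -> exists g,
          [/\ in_L2 g, L2_sum (fun s x => c s * u s x) g,
              (A%:E * l2_sqnorm c <= L2_sqnorm g)%E &
              (L2_sqnorm g <= B%:E * l2_sqnorm c)%E]]].

End riesz_basis.

Definition structured_riesz_basis (R : realType) (d k : nat) (M : 'M[R]_d)
    (Omega : set 'cV[R]_d) :=
  exists a : 'I_k -> 'cV[R]_d,
    riesz_basis Omega [set p | dual_lattice M p.2]
      (fun p : 'I_k * 'cV[R]_d => expo (a p.1 + p.2)).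

(* Main.v *)
(** Take a_j = j alpha for j < k.  Over a point w of the fundamental domain I
    the fiber of Omega consists of k lattice points l, and a sum
    f = sum_j e_(a_j) F_j with Lambda-periodic F_j takes on them the values
    f(l + w) = sum_j z_l^j (e_(a_j)(w) F_j(w)), where z_l = e_alpha(l).  The z_l
    lie on the unit circle and are delta-separated, so the Vandermonde matrix
    (z_l^j) and its inverse are bounded uniformly in w.  Integrating over I gives
    A sum_j |F_j|^2 <= |f|^2 <= B sum_j |F_j|^2, with the norms of L^2(I) on the
    outside and that of L^2(Omega) in the middle.  For trigonometric polynomials
    F_j with frequencies in the dual lattice, Parseval on I turns this into the
    Riesz bounds.  For an arbitrary f in L^2(Omega) the F_j are found by
    inverting the Vandermonde matrix pointwise, and completeness of the
    exponentials e_h, h in H, in L^2(I) finishes the proof. *)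
From HB Require Import structures.
From mathcomp Require Import finmap.
From mathcomp Require Import all_boot all_order all_algebra.
From mathcomp Require Import all_classical all_reals all_analysis.
From mathcomp Require Import measurable_realfun complex ring lra.
Require Import Defs.

Set Implicit Arguments.
Unset Strict Implicit.
Unset Printing Implicit Defensive.
Import Order.TTheory GRing.Theory Num.Theory.
Import numFieldNormedType.Exports.

Local Open Scope classical_set_scope.
Local Open Scope ring_scope.

Local Notation normc := Normc.normc.

(** The obstacle in inverting the Vandermonde matrix pointwise is measurability of the F_j, since an
    enumeration of the fiber depends on w in an uncontrolled way. For a fixed choice of k lattice
    vectors, however, the points w of J whose fiber they enumerate form a measurable set, on which
    the matrix is constant and the F_j are, up to a phase, fixed combinations of translates of f.
    There are countably many choices, and uniqueness of the solution glues the pieces. The uniform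
    bound on the inverse comes from reading the unknowns as coefficients of a polynomial p,
    recovered from its values by repeatedly dividing p - p(z) by X - z; each division costs 2 /
    delta. Completeness of the e_h in L^2(I) rests on a closure argument: bounded real functions
    approximable by trigonometric polynomials form an algebra stable under bounded pointwise limits,
    so the sets with approximable indicator form a sigma-algebra. Sines and cosines put the
    half-spaces of the lattice coordinates into it. Passing from finite sums to l^2 families uses |x
    + y|^2 <= 2|x|^2 + 2|y|^2, hence the final constants A / 2 and 2 B. *)

Lemma ge0_integral_invariant dd (T : measurableType dd) (R : realType)
    (mu : {measure set T -> \bar R}) (phi : T -> T) (D : set T)
    (f : T -> \bar R) : measurable_fun setT phi ->
  (forall A, measurable A -> mu (phi @^-1` A) = mu A) ->
  measurable D -> measurable_fun D f -> {in D, forall x, (0 <= f x)%E} ->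
  (\int[mu]_(x in phi @^-1` D) f (phi x) = \int[mu]_(x in D) f x)%E.
Proof.
move=> mphi inv mD mf f0.
rewrite -(@ge0_integral_pushforward _ _ _ _ _ _ mphi mu)//.
by apply: eq_measure_integral => //= B mB _; exact: inv.
Qed.

(** * Lebesgue measure on R^d *)

Section lebesgue_translation.
Local Open Scope ereal_scope.
Context {R : realType}.

Let shift1 (t x : measurableTypeR R) : measurableTypeR R := (x + t)%R.

Let measurable_shift1 t : measurable_fun setT (shift1 t).
Proof. exact: measurable_funD. Qed.

Lemma lebesgue_measure_shift (t : R) (A : set (measurableTypeR R)) :
  measurable A ->
  lebesgue_measure ((fun x : R => (x + t)%R) @^-1` A) = lebesgue_measure A.
Proof.
move=> mA.
have mt := measurable_shift1 t.
transitivity (pushforward lebesgue_measure (shift1 t) A) => //.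
apply/esym/lebesgue_measure_unique => //= _ [[a b]] _ <-.
rewrite /pushforward (_ : _ @^-1` _ = [set` `](a - t)%R, (b - t)%R]]); last first.
  by apply/seteqP; split=> x /=; rewrite !in_itv/= /shift1 ltrBlDr lerBrDr.
rewrite !lebesgue_measure_itv/= !lte_fin ltrD2r.
by case: ifP => // _; rewrite -!EFinB; congr (_%:E); ring.
Qed.

Lemma measurable_cV_shift d (t : 'cV[R]_d) :
  measurable_fun setT (fun x : 'cV[R]_d => (x + t)%R).
Proof.
apply: measurable_fun_cV => i.
rewrite (_ : _ \o _ = fun x => (cV_coord i x + t i ord0)%R); last first.
  by apply/funext => x; rewrite /cV_coord /= mxE.
apply: measurable_funD => //; exact: measurable_cV_coord.
Qed.

(** Induction on d by Fubini: the section at x of the shifted set is a shift of the section of A at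
    x + t0, so the induction hypothesis treats the inner measure and one-dimensional invariance the
    outer integral. *)
Lemma borel_lebesgue_shift d (t : 'cV[R]_d) (A : set 'cV[R]_d) :
  measurable A ->
  borel_lebesgue R d ((fun x : 'cV[R]_d => (x + t)%R) @^-1` A)
    = borel_lebesgue R d A.
Proof.
elim: d t A => [|d IHd] t A mA.
  by congr (borel_lebesgue R 0 _); apply/funext => x; rewrite /preimage /mkset;
    congr (A _); apply/matrixP => -[].
rewrite /= /lebesgue_cons /pushforward.
pose m := borel_lebesgue R d.
pose t0 := (cV_uncons t).1; pose t' := (cV_uncons t).2.
have mC B : measurable B -> measurable (@cV_cons R d @^-1` B).
  by move=> mB; rewrite -[X in measurable X]setTI; exact: measurable_cV_cons.
have mAs : measurable (cV_cons @^-1`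
    ((fun x : 'cV[R]_d.+1 => (x + t)%R) @^-1` A)).
  by apply: mC; rewrite -[X in measurable X]setTI; exact: measurable_cV_shift.
have consD x y : (cV_cons (x, y) + t = cV_cons ((x + t0)%R, y + t'))%R.
  rewrite /cV_cons /t0 /t' /cV_uncons /= -[t in LHS](@vsubmxK _ 1 d).
  rewrite (@add_col_mx _ 1 d) raddfD/=.
  congr (@col_mx _ 1 d 1 (_ + _) _)%R.
  apply/matrixP => i j; rewrite !ord1 !mxE mulr1n.
  by congr (t _ _); exact: val_inj.
rewrite /product_measure1.
pose g x := m (xsection (cV_cons @^-1` A) x).
transitivity (\int[lebesgue_measure]_x g (shift1 t0 x)).
  apply: eq_integral => x _ /=; rewrite /g /m -[in RHS](IHd t'); last first.
    by apply: measurable_xsection; exact: mC.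
  congr (borel_lebesgue R d _); apply/seteqP; split => y;
    by rewrite /xsection/= !inE/= consD.
have mg : measurable_fun setT g by apply: measurable_fun_xsection; exact: mC.
rewrite -[LHS]/(\int[lebesgue_measure]_(x in shift1 t0 @^-1` setT) g (shift1 t0 x)).
by apply: ge0_integral_invariant => // B mB; exact: lebesgue_measure_shift.
Qed.

Context {d : nat}.
Implicit Types (A B D : set 'cV[R]_d) (t : 'cV[R]_d).

Lemma borel_lebesgue_measurable A : measurable A -> lebesgue_measurable A.
Proof. exact: caratheodory_measurable_mu_ext. Qed.

Lemma lebesgue_borelE A : measurable A -> lebesgue R d A = borel_lebesgue R d A.
Proof. by move=> mA; exact: measurable_mu_extE. Qed.

(** As an outer measure, [lebesgue] is defined on every A: a Borel cover of A pulls back to a Borel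
    cover of the same total measure. The shift by -t gives the reverse inequality. *)
Let shift_le t A :
  lebesgue R d ((fun x : 'cV[R]_d => (x + t)%R) @^-1` A) <= lebesgue R d A.
Proof.
apply: le_ereal_inf_tmp => _ [F [mF AF] <-].
apply: ereal_inf_lbound.
exists (fun k => (fun x : 'cV[R]_d => (x + t)%R) @^-1` (F k)).
  split=> [k|x Ax].
    by rewrite -[X in measurable X]setTI; exact: measurable_cV_shift.
  by have [k _ Fk] := AF _ Ax; exists k.
by apply: eq_eseriesr => k _; exact: borel_lebesgue_shift.
Qed.

Let preimage_shiftK t A : (fun x : 'cV[R]_d => (x - t)%R) @^-1`
  ((fun x : 'cV[R]_d => (x + t)%R) @^-1` A) = A.
Proof. by apply/seteqP; split=> x /=; rewrite subrK. Qed.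

Lemma lebesgue_shift t A :
  lebesgue R d ((fun x : 'cV[R]_d => (x + t)%R) @^-1` A) = lebesgue R d A.
Proof.
apply/eqP; rewrite eq_le shift_le/=.
by rewrite -[A in X in X <= _](preimage_shiftK t) shift_le.
Qed.

Lemma lebesgue_measurable_shift t A : lebesgue_measurable A ->
  lebesgue_measurable ((fun x : 'cV[R]_d => (x + t)%R) @^-1` A).
Proof.
move=> mA.
(* Measurability unfolds to Carathéodory's criterion, so invariance of the outer measure on
   arbitrary test sets X transports it. *)
have {}mA X : lebesgue R d X = lebesgue R d (X `&` A) + lebesgue R d (X `&` ~` A).
  exact: mA.
suff : forall X, lebesgue R d X =
    lebesgue R d (X `&` ((fun x : 'cV[R]_d => (x + t)%R) @^-1` A)) +
    lebesgue R d (X `&` ~` ((fun x : 'cV[R]_d => (x + t)%R) @^-1` A)) by [].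
move=> X; rewrite -(lebesgue_shift (- t) X) mA.
congr (_ + _); rewrite -(lebesgue_shift t) preimage_setI;
  by congr (lebesgue R d (_ `&` _)); apply/seteqP; split=> x /=; rewrite addrK.
Qed.

Lemma measurable_fun_shift t :
  measurable_fun setT (fun x : lebesgue_space R d => (x + t)%R : lebesgue_space R d).
Proof. by move=> _ A mA; rewrite setTI; exact: lebesgue_measurable_shift. Qed.

Lemma ge0_integral_shift t (D : set (lebesgue_space R d))
    (f : lebesgue_space R d -> \bar R) :
  measurable D -> measurable_fun D f -> (forall x, 0 <= f x) ->
  \int[lebesgue R d]_(x in (fun x => (x + t)%R) @^-1` D) f (x + t)%R =
  \int[lebesgue R d]_(x in D) f x.
Proof.
move=> mD mf f0.
have f0' : {in D, forall x, 0 <= f x} by move=> x _.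
have inv (A : set (lebesgue_space R d)) : measurable A ->
    lebesgue R d ((fun x : lebesgue_space R d => (x + t)%R : lebesgue_space R d) @^-1` A)
    = lebesgue R d A by move=> _; exact: lebesgue_shift.
have := @ge0_integral_invariant _ (lebesgue_space R d) R (lebesgue R d) _ D f
  (measurable_fun_shift t) inv mD mf f0'.
exact.
Qed.

End lebesgue_translation.

(** * Measure of boxes and Borel hulls *)

Section lebesgue_facts.
Local Open Scope ereal_scope.
Context {R : realType}.

Lemma measurable_cV_forall d (P : 'I_d -> set (measurableTypeR R)) :
  (forall i, measurable (P i)) ->
  measurable [set x : 'cV[R]_d | forall i, P i (x i ord0)].
Proof.
move=> mP.
rewrite (_ : [set _ | _] = \bigcap_(i in [set: 'I_d]) (cV_coord i @^-1` P i)).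
  apply: fin_bigcap_measurable => // i _.
  by rewrite -[X in measurable X]setTI; exact: measurable_cV_coord.
by apply/seteqP; split=> x /= Px i => [_|]; exact: Px.
Qed.

Let cV_cons0 d (x : measurableTypeR R) (y : 'cV[R]_d) :
  cV_cons (x, y) ord0 ord0 = x.
Proof. by have [] := cV_consK (x, y). Qed.

Let cV_consS d (x : measurableTypeR R) (y : 'cV[R]_d) (i : 'I_d) :
  cV_cons (x, y) (lift ord0 i) ord0 = y i ord0.
Proof.
rewrite /cV_cons (_ : lift ord0 i = rshift 1 i); last exact: val_inj.
exact: (@col_mxEd _ 1).
Qed.

Lemma borel_lebesgue_box d (C : R) :
  borel_lebesgue R d [set x | forall i, (`|x i ord0| <= C)%R] < +oo.
Proof.
have mI : measurable ([set` `[(- C)%R, C]] : set (measurableTypeR R)) by [].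
elim: d => [|d IHd].
  rewrite [borel_lebesgue R 0 _]diracE; exact: ltry.
rewrite /= /lebesgue_cons /pushforward.
have boxE : forall S : set (measurableTypeR R * 'cV[R]_d),
    S = [set` `[(- C)%R, C]] `*` [set x : 'cV[R]_d | forall i, (`|x i ord0| <= C)%R] ->
    (@lebesgue_measure R \x borel_lebesgue R d) S < +oo.
  move=> _ ->; rewrite product_measure1E//; last first.
    have := @measurable_cV_forall d (fun=> [set` `[(- C)%R, C]]) (fun=> mI).
    by congr measurable; apply/seteqP; split=> x /= + i => /(_ i); rewrite in_itv/= ler_norml.
  apply: lte_mul_pinfty => //.
  have : lebesgue_measure ([set` `[(- C)%R, C]] : set R) \is a fin_num.
    by rewrite ge0_fin_numE// lebesgue_measure_itv/=; case: ifP; rewrite ltry.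
  exact.
apply: boxE.
apply/seteqP; split => -[x y] /=.
  move=> xy; split => [|i].
    by have := xy ord0; rewrite cV_cons0 in_itv/= ler_norml.
  by have := xy (lift ord0 i); rewrite cV_consS.
rewrite in_itv/= -ler_norml => -[x1 y1] i.
by case: (unliftP ord0 i) => [j|] ->; rewrite ?cV_cons0 ?cV_consS.
Qed.

Lemma borel_lebesgueT_gt0 d : 0 < borel_lebesgue R d setT.
Proof.
elim: d => [|d IHd]; first by rewrite [borel_lebesgue R 0 _]diracE in_setT lte01.
rewrite /= /lebesgue_cons /pushforward preimage_setT -setXTT.
rewrite product_measure1E// mule_gt0//.
have -> : setT = [set` `]-oo, +oo[] :> set (measurableTypeR R).
  by apply/seteqP; split=> x //=; rewrite in_itv.
have : lebesgue_measure ([set` `]-oo, +oo[] : set R) = +oo.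
  by rewrite lebesgue_measure_itv.
by move=> e; rewrite [X in _ < X]e ltry.
Qed.

Context {d : nat}.
Implicit Types A : set 'cV[R]_d.

(** The hull is the intersection over n of countable Borel covers whose total exceeds the measure of
    A by less than 1/(n+1). Finiteness allows the subtraction that makes the difference null. *)
Lemma lebesgue_borel_hull A : lebesgue_measurable A -> lebesgue R d A < +oo ->
  exists B : set 'cV[R]_d,
    [/\ measurable B, A `<=` B & lebesgue R d (B `\` A) = 0].
Proof.
move=> mA fA.
have finA : lebesgue R d A \is a fin_num by rewrite ge0_fin_numE.
have /choice[F FP] n : exists F : (set 'cV[R]_d)^nat,
    [/\ forall i, measurable (F i), A `<=` \bigcup_k F k &
     \sum_(k <oo) borel_lebesgue R d (F k) < lebesgue R d A + (n.+1%:R^-1)%:E].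
  have [] := @lb_ereal_inf_adherent _
    [set \sum_(k <oo) borel_lebesgue R d (F k) | F in measurable_cover A]
    (n.+1%:R^-1) _ finA; first by rewrite invr_gt0.
  by move=> _ [F [mF AF] <-] lt; exists F.
pose B := \bigcap_n \bigcup_k F n k.
have mB : measurable B.
  by apply: bigcap_measurable => // n _; apply: bigcup_measurable => k _;
    have [] := FP n.
have AB : A `<=` B by move=> x Ax n _; have [_ AF _] := FP n; exact: AF.
exists B; split => //.
have mB' := borel_lebesgue_measurable mB.
have BA : lebesgue R d B <= lebesgue R d A.
  apply/lee_addgt0Pr => _ /posnumP[e].
  have [n _ ne] : exists2 n, True & (n.+1%:R^-1 <= e%:num)%R.
    have [n ne] := @ltr_add_invr R 0 e%:num (gt0 e).
    by exists n => //; rewrite add0r in ne; exact: ltW.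
  have [mF AF lt] := FP n.
  apply: (@le_trans _ _ (\sum_(k <oo) borel_lebesgue R d (F n k))).
    rewrite lebesgue_borelE//.
    apply: (@le_trans _ _ (borel_lebesgue R d (\bigcup_k F n k))).
      by apply: le_measure; rewrite ?inE//; [exact: bigcup_measurable|move=> x; apply].
    by apply: measure_sigma_subadditive => //; exact: bigcup_measurable.
  by apply: (le_trans (ltW lt)); rewrite leeD2l// lee_fin.
have muBA := @measureD _ (lebesgue_space R d) R (lebesgue R d) B A mB' mA.
have BAlt : lebesgue R d B < +oo by exact: le_lt_trans fA.
have AleB : lebesgue R d A <= lebesgue R d B.
  exact: le_mu_ext.
have e : lebesgue R d B = lebesgue R d A by apply/eqP; rewrite eq_le BA.
have {}muBA : lebesgue R d (B `\` A) = lebesgue R d B - lebesgue R d (B `&` A).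
  exact: muBA.
by rewrite muBA setIidr// e subee.
Qed.

End lebesgue_facts.

(** * Square-integrable complex functions *)

Section complex_square.
Context {R : realType}.
Implicit Types z w : R[i].

Lemma sqr_normcE z : normc z ^+ 2 = complex.Re z ^+ 2 + complex.Im z ^+ 2.
Proof. by case: z => a b; rewrite /normc sqr_sqrtr// addr_ge0// sqr_ge0. Qed.

Lemma normc_ge0 z : 0 <= normc z.
Proof. by case: z => a b; exact: sqrtr_ge0. Qed.

Lemma normc_real (a : R) : normc (a%:C)%C = `|a|.
Proof. by rewrite /normc/= expr0n addr0 sqrtr_sqr. Qed.

Lemma sqr_normcM z w : normc (z * w) ^+ 2 = normc z ^+ 2 * normc w ^+ 2.
Proof. by rewrite Normc.normcM exprMn. Qed.

Lemma normc_sum (I : Type) (r : seq I) (P : pred I) (F : I -> R[i]) :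
  normc (\sum_(i <- r | P i) F i) <= \sum_(i <- r | P i) normc (F i).
Proof.
elim/big_ind2 : _ => //; first by rewrite Normc.normc0.
by move=> x x' y y' xx' yy'; apply: (le_trans (le_normcD _ _)); exact: lerD.
Qed.

Lemma sqr_normcD z w :
  normc (z + w) ^+ 2 <= 2 * normc z ^+ 2 + 2 * normc w ^+ 2.
Proof.
have le1 : normc (z + w) ^+ 2 <= (normc z + normc w) ^+ 2.
  by rewrite lerXn2r ?nnegrE ?normc_ge0 ?addr_ge0 ?normc_ge0// le_normcD.
apply: (le_trans le1).
by have := sqr_ge0 (normc z - normc w); rewrite sqrrB sqrrD; lra.
Qed.

Lemma sqr_normc_sum k (F : 'I_k -> R[i]) :
  normc (\sum_i F i) ^+ 2 <= k%:R * \sum_i normc (F i) ^+ 2.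
Proof.
(* Weighted Young inequality 2ab <= K a^2 + b^2 / K, obtained from the square of K a - b. *)
have cauchy (K a b s : R) : 0 < K -> b ^+ 2 <= K * s ->
    (a + b) ^+ 2 <= (K + 1) * (a ^+ 2 + s).
  move=> K0 bs; have b1 : K^-1 * b ^+ 2 <= s by rewrite ler_pdivrMl.
  have ab : 0 <= K^-1 * (K * a - b) ^+ 2 by rewrite mulr_ge0 ?sqr_ge0// invr_ge0 ltW.
  have abE : K^-1 * (K * a - b) ^+ 2 = K * a ^+ 2 + K^-1 * b ^+ 2 - 2 * (a * b).
    by field; exact: lt0r_neq0.
  have -> : (a + b) ^+ 2 = a ^+ 2 + b ^+ 2 + 2 * (a * b) by ring.
  have -> : (K + 1) * (a ^+ 2 + s) = K * a ^+ 2 + K * s + a ^+ 2 + s by ring.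
  by rewrite abE in ab; lra.
elim: k F => [|k IHk] F; first by rewrite !big_ord0 Normc.normc0 expr0n mulr0.
(* [cauchy] divides by K, so a sum with a single term is treated apart. *)
have [k0|k0] := posnP k.
  by move: F; rewrite k0 => F; rewrite !big_ord_recl !big_ord0 !addr0 mul1r.
rewrite !big_ord_recl -natr1; apply: (@le_trans _ _
   ((normc (F ord0) + normc (\sum_(i < k) F (lift ord0 i))) ^+ 2)).
  by rewrite lerXn2r ?nnegrE ?normc_ge0 ?addr_ge0 ?normc_ge0// le_normcD.
by apply: cauchy; [rewrite ltr0n|exact: IHk].
Qed.

Lemma complex_ReM z w : complex.Re (z * w) =
  complex.Re z * complex.Re w - complex.Im z * complex.Im w.
Proof. by case: z w => [a b] []. Qed.

Lemma complex_ImM z w : complex.Im (z * w) =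
  complex.Re z * complex.Im w + complex.Im z * complex.Re w.
Proof. by case: z w => [a b] []. Qed.

End complex_square.

Section cmeasurable.
Context {R : realType} {dd} {T : measurableType dd}.
Implicit Types (X : set T) (f g : T -> R[i]).

Definition cmeasurable X f :=
  measurable_fun X (fun x => complex.Re (f x)) /\
  measurable_fun X (fun x => complex.Im (f x)).

Lemma cmeasurable_cst X (c : R[i]) : cmeasurable X (fun=> c).
Proof. by split; exact: measurable_cst. Qed.

Lemma cmeasurableD X f g : cmeasurable X f -> cmeasurable X g ->
  cmeasurable X (fun x => f x + g x).
Proof.
by move=> [fr fi] [gr gi]; split;
  [under eq_fun do rewrite raddfD/=|under eq_fun do rewrite raddfD/=];
  exact: measurable_funD.
Qed.

Lemma cmeasurableM X f g : cmeasurable X f -> cmeasurable X g ->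
  cmeasurable X (fun x => f x * g x).
Proof.
move=> [fr fi] [gr gi]; split.
- under eq_fun do rewrite complex_ReM.
  by apply: measurable_funB; exact: measurable_funM.
- under eq_fun do rewrite complex_ImM.
  by apply: measurable_funD; exact: measurable_funM.
Qed.

Lemma cmeasurableZ X (c : R[i]) f : cmeasurable X f ->
  cmeasurable X (fun x => c * f x).
Proof. by apply: cmeasurableM; exact: cmeasurable_cst. Qed.

Lemma cmeasurableN X f : cmeasurable X f -> cmeasurable X (fun x => - f x).
Proof.
by move=> mf; under eq_fun do rewrite -mulN1r; exact: cmeasurableZ.
Qed.

Lemma cmeasurableB X f g : cmeasurable X f -> cmeasurable X g ->
  cmeasurable X (fun x => f x - g x).
Proof. by move=> mf mg; apply: cmeasurableD => //; exact: cmeasurableN. Qed.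

Lemma cmeasurable_sum X (I : eqType) (r : seq I) (F : I -> T -> R[i]) :
  (forall i, i \in r -> cmeasurable X (F i)) ->
  cmeasurable X (fun x => \sum_(i <- r) F i x).
Proof.
elim: r => [|i r IHr] mF.
  by under eq_fun do rewrite big_nil; exact: cmeasurable_cst.
under eq_fun do rewrite big_cons; apply: cmeasurableD.
  by apply: mF; rewrite mem_head.
by apply: IHr => j jr; apply: mF; rewrite inE jr orbT.
Qed.

Lemma cmeasurable_real X (u : T -> R) : measurable_fun X u ->
  cmeasurable X (fun x => (u x)%:C%C).
Proof. by move=> mu; split => //=; exact: measurable_cst. Qed.

Lemma cmeasurableS X Y f : measurable Y -> X `<=` Y ->
  cmeasurable Y f -> cmeasurable X f.
Proof. by move=> mY XY [? ?]; split; apply: (measurable_funS mY). Qed.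

Lemma measurable_sqr_normc X f : cmeasurable X f ->
  measurable_fun X (fun x => (normc (f x) ^+ 2)%:E).
Proof.
move=> [mr mi]; apply/measurable_EFinP; under eq_fun do rewrite sqr_normcE.
by apply: measurable_funD; exact: measurable_funX.
Qed.

End cmeasurable.

(** * Squared L^2 norms over a measurable set *)

Section Lsq.
Local Open Scope ereal_scope.
Context {R : realType} {dd} {T : measurableType dd}.
Variable mu : {measure set T -> \bar R}.
Implicit Types (X Y : set T) (f g : T -> R[i]).

Definition Lsq X f : \bar R := \int[mu]_(x in X) (normc (f x) ^+ 2)%:E.

Let sqr_normc_ge0 (z : R[i]) : 0 <= (normc z ^+ 2)%:E.
Proof. by rewrite lee_fin sqr_ge0. Qed.

Lemma Lsq_ge0 X f : 0 <= Lsq X f.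
Proof. by apply: integral_ge0 => x _; rewrite lee_fin sqr_ge0. Qed.

Lemma eq_Lsq X f g : (forall x, X x -> f x = g x) -> Lsq X f = Lsq X g.
Proof. by move=> fg; apply: eq_integral => x /set_mem/fg ->. Qed.

Lemma LsqM_le X (h f : T -> R[i]) (K : R) : measurable X ->
  cmeasurable X h -> cmeasurable X f -> (0 <= K)%R ->
  (forall x, X x -> (normc (h x) ^+ 2 <= K)%R) ->
  Lsq X (fun x => h x * f x)%R <= K%:E * Lsq X f.
Proof.
move=> mX mh mf K0 hK; rewrite /Lsq -ge0_integralZl//; last exact: measurable_sqr_normc.
apply: ge0_le_integral => //.
- exact/measurable_sqr_normc/cmeasurableM.
- by apply: emeasurable_funM => //; exact: measurable_sqr_normc.
- by move=> x Xx; rewrite -EFinM lee_fin sqr_normcM ler_wpM2r ?sqr_ge0// hK.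
Qed.

Lemma LsqN X f : Lsq X (fun x => - f x)%R = Lsq X f.
Proof. by apply: eq_integral => x _; rewrite normcN. Qed.

Lemma LsqD X f g : measurable X -> cmeasurable X f -> cmeasurable X g ->
  Lsq X (fun x => f x + g x)%R <= 2%:E * Lsq X f + 2%:E * Lsq X g.
Proof.
move=> mX mf mg; have mf2 := measurable_sqr_normc mf.
have mg2 := measurable_sqr_normc mg.
have [f0 g0] : (forall x, X x -> 0 <= (normc (f x) ^+ 2)%:E) /\
  (forall x, X x -> 0 <= (normc (g x) ^+ 2)%:E) by split=> x _.
rewrite /Lsq -(ge0_integralZl mu mX mf2 f0)// -(ge0_integralZl mu mX mg2 g0)//.
rewrite -ge0_integralD//; last 4 first.
- by move=> x _; rewrite -EFinM lee_fin mulr_ge0// sqr_ge0.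
- exact: emeasurable_funM.
- by move=> x _; rewrite -EFinM lee_fin mulr_ge0// sqr_ge0.
- exact: emeasurable_funM.
apply: ge0_le_integral => //.
- exact/measurable_sqr_normc/cmeasurableD.
- by apply: emeasurable_funD; exact: emeasurable_funM.
- by move=> x _; rewrite -!EFinM -EFinD lee_fin sqr_normcD.
Qed.

Lemma LsqD_lt X f g (e1 e2 : R) : measurable X -> cmeasurable X f ->
  cmeasurable X g -> Lsq X f < e1%:E -> Lsq X g < e2%:E ->
  Lsq X (fun x => f x + g x)%R < (2 * e1 + 2 * e2)%:E.
Proof.
move=> mX mf mg fe ge; apply: (le_lt_trans (LsqD mX mf mg)).
have : 2%:E * Lsq X f + 2%:E * Lsq X g < 2%:E * e1%:E + 2%:E * e2%:E.
  by rewrite lteD// lte_pmul2l.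
exact.
Qed.

Lemma LsqS X Y f : measurable X -> measurable Y -> X `<=` Y ->
  cmeasurable Y f -> Lsq X f <= Lsq Y f.
Proof.
move=> mX mY XY mf; apply: ge0_subset_integral => //.
exact: measurable_sqr_normc.
Qed.

Lemma Lsq_dct X (f_ : (T -> R[i])^nat) (G : T -> R) : measurable X ->
  (forall n, cmeasurable X (f_ n)) -> measurable_fun X G ->
  \int[mu]_(x in X) (G x)%:E < +oo ->
  (forall n x, X x -> (normc (f_ n x) ^+ 2 <= G x)%R) ->
  (forall x, X x -> (normc (f_ n x) ^+ 2)%R @[n --> \oo] --> (0 : R)%R) ->
  forall e : R, (0 < e)%R -> exists n, Lsq X (f_ n) < e%:E.
Proof.
move=> mX mf mG Goo fG f0 e e0.
have G0 x : X x -> (0 <= G x)%R.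
  by move=> Xx; apply: le_trans (fG 0%N x Xx); exact: sqr_ge0.
have [||||_ _] := @dominated_convergence _ T R mu X mX
  (fun n x => (normc (f_ n x) ^+ 2)%:E) (cst 0) (EFin \o G)
  (fun n => measurable_sqr_normc (mf n)).
- exact: measurable_cst.
- by apply: aeW => x Xx; apply: cvg_EFin; [exact: nearW|exact: f0].
- apply/integrableP; split; first exact/measurable_EFinP.
  under eq_integral => x /set_mem/G0 x0 do rewrite /= ger0_norm//.
  exact: Goo.
- by apply: aeW => x n Xx; rewrite gee0_abs ?lee_fin ?sqr_ge0// fG.
rewrite integral0 => cv.
have : \forall n \near \oo, Lsq X (f_ n) < e%:E.
  by apply: (cv [set y | y < e%:E]); apply: open_ereal_lt'; rewrite lte_fin.
by case=> N _ /(_ N (leqnn N)); exists N.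
Qed.

(** The rate 8^-n absorbs the weight 4^n and leaves the summable 2^-n; the weight itself is what
    [cvg_sqr_summable] consumes. *)
Lemma Lsq_series_finite X (f_ : (T -> R[i])^nat) : measurable X ->
  (forall n, cmeasurable X (f_ n)) ->
  (forall n, Lsq X (f_ n) <= (8^-1 ^+ n)%:E) ->
  \int[mu]_(x in X) (\sum_(n <oo) (4 ^+ n * normc (f_ n x) ^+ 2)%:E) < +oo.
Proof.
move=> mX mf f8; rewrite integral_nneseries//; last 2 first.
- move=> n; apply/measurable_EFinP/measurable_funM => //.
  exact/measurable_EFinP/measurable_sqr_normc.
- by move=> n x _; rewrite lee_fin mulr_ge0// sqr_ge0.
apply: (@le_lt_trans _ _ (\sum_(n <oo) (2^-1 ^+ n)%:E)).
  apply: lee_nneseries => [n _ _|n _]; first by apply: integral_ge0 => x _;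
    rewrite lee_fin mulr_ge0// sqr_ge0.
  have -> : \int[mu]_(x in X) (4 ^+ n * normc (f_ n x) ^+ 2)%:E =
      (4 ^+ n)%:E * Lsq X (f_ n).
    rewrite /Lsq -ge0_integralZl//; exact: measurable_sqr_normc.
  apply: (@le_trans _ _ ((4 ^+ n)%:E * (8^-1 ^+ n)%:E)).
    by rewrite lee_pmul2l// lte_fin exprn_gt0.
  rewrite -EFinM lee_fin -exprMn lerXn2r// ?nnegrE//; lra.
have cv := @cvg_geometric_series R 1 2^-1.
rewrite (_ : \sum_(n <oo) _ = (1 / (1 - 2^-1))%:E) ?ltry//.
apply/cvg_lim => //.
have -> : (fun n => \sum_(0 <= k < n) ((2^-1 : R) ^+ k)%:E) =
   EFin \o (series (geometric (1 : R) 2^-1)).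
  apply/funext => n /=; rewrite /series/= -sumEFin.
  by apply: eq_bigr => i _; rewrite /geometric/= mul1r.
by apply: cvg_EFin; [exact: nearW|apply: cv; rewrite ger0_norm; lra].
Qed.

End Lsq.

(** Each term is at most the sum K, so the increments are at most sqrt(K) 2^-n and the telescoping
    series converges absolutely. *)
Lemma cvg_sqr_summable {R : realType} (a : R^nat) :
  (\sum_(n <oo) (4 ^+ n * (a n.+1 - a n) ^+ 2)%:E < +oo)%E -> cvgn a.
Proof.
move=> aoo.
have u0 n : (0 <= (4 ^+ n * (a n.+1 - a n) ^+ 2)%:E)%E.
  by rewrite lee_fin mulr_ge0// sqr_ge0.
have [K K0 aK] : exists2 K, 0 <= K & forall n, 4 ^+ n * (a n.+1 - a n) ^+ 2 <= K.
  exists (fine (\sum_(n <oo) (4 ^+ n * (a n.+1 - a n) ^+ 2)%:E)).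
    by apply: fine_ge0; exact: nneseries_ge0.
  move=> n; rewrite -lee_fin fineK; last by rewrite ge0_fin_numE// nneseries_ge0.
  rewrite (@nneseriesD1 _ _ n)// leeDl//; exact: nneseries_ge0.
have step n : `|a n.+1 - a n| <= geometric (Num.sqrt K) 2^-1 n.
  rewrite /geometric/= -(@ler_pXn2r _ 2)// ?nnegrE ?mulr_ge0 ?sqrtr_ge0//.
  rewrite real_normK ?num_real// exprMn sqr_sqrtr// -exprM mulnC exprM.
  rewrite -(@ler_pM2l _ (4 ^+ n)) ?exprn_gt0//.
  rewrite [leRHS]mulrCA -exprMn (_ : 4 * 2^-1 ^+ 2 = 1 :> R) ?expr1n ?mulr1//.
  by field.
have /normed_cvg cs : cvgn [normed series (telescope a)].
  apply: (series_le_cvg _ _ step) => n.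
  - exact: normr_ge0.
  - by rewrite /geometric/= mulr_ge0// ?sqrtr_ge0// exprn_ge0.
  - by apply: is_cvg_geometric_series; rewrite ger0_norm; lra.
rewrite (_ : a = (fun n => a 0%N + series (telescope a) n)).
  exact: is_cvgD (is_cvg_cst _) cs.
by apply/funext => n; rewrite telescopeK addrC subrK.
Qed.

(** * Completeness of L^2 *)

Section riesz_fischer.
Local Open Scope ereal_scope.
Context {R : realType} {dd} {T : measurableType dd}.
Variable mu : {measure set T -> \bar R}.
Implicit Types (X Y : set T) (f g : T -> R[i]).

(* A sequence whose increments have squared norms at most 8^-n converges
   pointwise almost everywhere, because the sum of 4^n |f_(n+1) - f_n|^2 is
   integrable; Fatou's lemma gives convergence in L^2. *)
Lemma Lsq_complete X (f_ : (T -> R[i])^nat) : measurable X ->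
  (forall n, cmeasurable X (f_ n)) ->
  (forall n m, (n <= m)%N ->
    Lsq mu X (fun x => f_ m x - f_ n x)%R <= (8^-1 ^+ n)%:E) ->
  exists2 g, cmeasurable X g &
    forall n, Lsq mu X (fun x => g x - f_ n x)%R <= (8^-1 ^+ n)%:E.
Proof.
move=> mX mf f8.
pose h x := \sum_(n <oo) (4 ^+ n * normc (f_ n.+1 x - f_ n x) ^+ 2)%:E.
have mdf n : cmeasurable X (fun x => f_ n.+1 x - f_ n x)%R by exact: cmeasurableB.
have h0 x : 0 <= h x.
  by apply: nneseries_ge0 => n _ _; rewrite lee_fin mulr_ge0// sqr_ge0.
have mh : measurable_fun X h.
  apply: ge0_emeasurable_sum => n.
    by move=> x _ _; rewrite lee_fin mulr_ge0// sqr_ge0.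
  move=> _; apply/measurable_EFinP/measurable_funM => //.
  exact/measurable_EFinP/measurable_sqr_normc.
have hoo : \int[mu]_(x in X) h x < +oo.
  by apply: Lsq_series_finite => // n; exact: f8.
have ih : mu.-integrable X h.
  by apply/integrableP; split=> //; under eq_integral do rewrite gee0_abs//.
have [N [mN N0 hN]] := integrable_ae mX ih.
pose D := X `\` N.
have mD : measurable D by exact: measurableD.
have DX : D `<=` X by move=> x [].
have hD x : D x -> h x < +oo.
  move=> [Xx Nx]; rewrite -ge0_fin_numE//; apply: contrapT => hx.
  by apply/Nx/hN => /(_ Xx).
(* To be used with p the real and the imaginary part, both dominated by the modulus. *)
have cvD (p : R[i] -> R) : (forall z w, p (z - w)%R = (p z - p w)%R) ->
    (forall z, (p z ^+ 2 <= normc z ^+ 2)%R) ->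
    forall x, D x -> cvgn (fun n => p (f_ n x)).
  move=> pB p2 x Dx; apply: cvg_sqr_summable; apply: le_lt_trans (hD _ Dx).
  apply: lee_nneseries => [n _ _|n _]; first by rewrite lee_fin mulr_ge0// sqr_ge0.
  by rewrite lee_fin ler_wpM2l// -pB p2.
have cvr x : D x -> cvgn (fun n => complex.Re (f_ n x)).
  apply: cvD => [z w|z]; first by rewrite raddfB.
  by rewrite sqr_normcE lerDl sqr_ge0.
have cvi x : D x -> cvgn (fun n => complex.Im (f_ n x)).
  apply: cvD => [z w|z]; first by rewrite raddfB.
  by rewrite sqr_normcE lerDr sqr_ge0.
pose gr x : R := if x \in N then 0%R else limn (fun n => complex.Re (f_ n x)).
pose gi x : R := if x \in N then 0%R else limn (fun n => complex.Im (f_ n x)).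
have mlim (p : T -> R[i] -> R) (q : T -> R)
    (qE : q = fun x => if x \in N then 0%R else limn (fun n => p x (f_ n x))) :
    (forall n, measurable_fun X (fun x => p x (f_ n x))) ->
    (forall x, D x -> cvgn (fun n => p x (f_ n x))) -> measurable_fun X q.
  move=> mp cp; apply: (@measurable_fun_cvg _ _ _ _
    (fun n x => \1_(~` N) x * p x (f_ n x))%R) => [n|x Xx].
    apply: measurable_funM => //; apply: measurable_indic; exact: measurableC.
  rewrite qE indicE in_setC; case: ifPn => xN /=.
    by under eq_fun do rewrite mul0r; exact: cvg_cst.
  under eq_fun do rewrite mul1r; apply: cp; split => // /mem_set; exact/negP.
have mg : cmeasurable X (fun x => (gr x +i* gi x)%C).
  split => /=.
    by apply: (mlim (fun _ => @complex.Re R)) => // n; case: (mf n).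
  by apply: (mlim (fun _ => @complex.Im R)) => // n; case: (mf n).
exists (fun x => (gr x +i* gi x)%C) => // n.
have XD f : cmeasurable X f -> Lsq mu X f = Lsq mu D f.
  move=> mf'; apply: ge0_negligible_integral => //.
  - exact: measurable_sqr_normc.
  - by move=> x _; rewrite lee_fin sqr_ge0.
rewrite XD; last exact: cmeasurableB.
pose F m x : \bar R := (normc (f_ m x - f_ n x) ^+ 2)%:E.
have FE x : D x -> (normc ((gr x +i* gi x)%C - f_ n x) ^+ 2)%:E = limn_einf (F^~ x).
  move=> Dx; apply/esym; have NxF : (x \in N) = false.
    by apply/negbTE/negP => /set_mem; case: Dx.
  have cF : F m x @[m --> \oo] --> (normc ((gr x +i* gi x)%C - f_ n x) ^+ 2)%:E.
    apply: cvg_EFin; first exact: nearW.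
    rewrite sqr_normcE !raddfB/=.
    rewrite [X in X @ _ --> _](_ : _ = fun m =>
      (complex.Re (f_ m x) - complex.Re (f_ n x)) ^+ 2 +
      (complex.Im (f_ m x) - complex.Im (f_ n x)) ^+ 2)%R; last first.
      by apply/funext => m; rewrite /= sqr_normcE !raddfB.
    rewrite /gr /gi NxF.
    by apply: cvgD; under eq_fun do rewrite expr2; rewrite expr2; apply: cvgM;
      apply: cvgB; [exact: cvr|exact: cvg_cst|exact: cvr|exact: cvg_cst|
       exact: cvi|exact: cvg_cst|exact: cvi|exact: cvg_cst].
  by have /cvg_limn_einf_sup [-> _] := cF.
have -> : Lsq mu D (fun x => (gr x +i* gi x)%C - f_ n x)%R =
    \int[mu]_(x in D) limn_einf (F^~ x).
  by apply: eq_integral => x /set_mem/FE.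
(* Fatou's lemma in m, with n fixed. *)
apply: (le_trans (fatou mu mD _ _)).
- move=> m; apply: measurable_sqr_normc; apply: (cmeasurableS mX) => //.
  exact: cmeasurableB.
- by move=> m x _; rewrite lee_fin sqr_ge0.
rewrite limn_einf_lim; apply: lime_le; first exact: is_cvg_einfs.
(* The infimum over indices from k on is bounded by its term at maxn k n, an index beyond n to which
   the Cauchy estimate applies. *)
apply: nearW => k; apply: le_trans (ereal_inf_lbound _) _.
  by exists (maxn k n) => //=; exact: leq_maxl.
rewrite -/(Lsq mu D (fun x => f_ (maxn k n) x - f_ n x)%R).
apply: le_trans (f8 n (maxn k n) (leq_maxr _ _)).
by apply: LsqS => //; exact: cmeasurableB.
Qed.

End riesz_fischer.

(** * Finite linear combinations and their L^2 closure *)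

Section span.
Context {R : realType} {T : Type} {K : eqType}.
Variables (S : set K) (u : K -> T -> R[i]).
Implicit Types p q : T -> R[i].

(** A list of coefficient-index pairs may repeat an index, so sums and products of combinations are
    plain list operations; [span_fsets] merges the repetitions at the end. *)
Definition span p := exists2 s : seq (R[i] * K), (forall a, a \in s -> S a.2) &
  p = fun x => \sum_(a <- s) a.1 * u a.2 x.

Lemma span0 : span (fun=> 0).
Proof. by exists [::] => //; apply/funext => x; rewrite big_nil. Qed.

Lemma span1 k : S k -> span (u k).
Proof.
move=> Sk; exists [:: (1, k)]; first by move=> a; rewrite inE => /eqP ->.
by apply/funext => x; rewrite big_seq1 mul1r.
Qed.

Lemma spanD p q : span p -> span q -> span (fun x => p x + q x).
Proof.
move=> [s sS ->] [t tS ->]; exists (s ++ t); last first.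
  by apply/funext => x; rewrite big_cat.
by move=> a; rewrite mem_cat => /orP[/sS|/tS].
Qed.

Lemma spanZ c p : span p -> span (fun x => c * p x).
Proof.
move=> [s sS ->]; exists [seq (c * a.1, a.2) | a <- s].
  by move=> _ /mapP[a /sS aS ->].
apply/funext => x; rewrite big_map mulr_sumr.
by apply: eq_bigr => a _ /=; rewrite mulrA.
Qed.

Lemma span_sum (I : eqType) (r : seq I) (P : I -> T -> R[i]) :
  (forall i, i \in r -> span (P i)) -> span (fun x => \sum_(i <- r) P i x).
Proof.
elim: r => [|i r IHr] sP; first by under eq_fun do rewrite big_nil; exact: span0.
under eq_fun do rewrite big_cons; apply: spanD; first by apply: sP; rewrite mem_head.
by apply: IHr => j jr; apply: sP; rewrite inE jr orbT.
Qed.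

End span.

Section L2_closure.
Local Open Scope ereal_scope.
Context {R : realType} {dd} {T : measurableType dd} {K : eqType}.
Variables (mu : {measure set T -> \bar R}) (X : set T).
Variables (S : set K) (u : K -> T -> R[i]).
Hypotheses (mX : measurable X) (mu_ : forall k, S k -> cmeasurable X (u k)).
Implicit Types f g p q : T -> R[i].

Definition L2_closure f := forall e : R, (0 < e)%R ->
  exists2 p, span S u p & Lsq mu X (fun x => f x - p x)%R < e%:E.

Lemma cmeasurable_span p : span S u p -> cmeasurable X p.
Proof.
move=> [s sS ->]; apply: cmeasurable_sum => a as_.
by apply: cmeasurableZ; apply: mu_; exact: sS.
Qed.

Lemma eq_L2_closure f g : (forall x, X x -> f x = g x) -> L2_closure f -> L2_closure g.
Proof.
move=> fg af e /af[p sp fp]; exists p => //; apply: le_lt_trans fp.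
by rewrite le_eqVlt; apply/orP; left; apply/eqP/eq_Lsq => x /fg ->.
Qed.

Lemma span_L2_closure p : span S u p -> L2_closure p.
Proof.
move=> sp e e0; exists p => //; rewrite /Lsq (_ : \int[mu]_(x in X) _ = 0) ?lte_fin//.
rewrite (eq_integral (cst 0)) ?integral0// => x _.
by rewrite subrr Normc.normc0 expr0n.
Qed.

Lemma L2_closure_closed f : cmeasurable X f ->
  (forall e : R, (0 < e)%R -> exists g, [/\ cmeasurable X g, L2_closure g &
    Lsq mu X (fun x => f x - g x)%R < e%:E]) -> L2_closure f.
Proof.
move=> mf H e e0.
(* [LsqD_lt] doubles each of the two squared errors: 2 (e/4) + 2 (e/4) = e. *)
have e4 : (0 < e / 4)%R by lra.
have [g [mg /(_ _ e4)[p sp gp] fg]] := H _ e4.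
exists p => //.
have mp := cmeasurable_span sp.
have -> : (fun x => f x - p x)%R = (fun x => (f x - g x) + (g x - p x))%R.
  by apply/funext => x; rewrite addrA subrK.
have := LsqD_lt mX (cmeasurableB mf mg) (cmeasurableB mg mp) fg gp.
by rewrite (_ : 2 * _ + 2 * _ = e)%R//; field.
Qed.

Lemma L2_closureD f g : cmeasurable X f -> cmeasurable X g ->
  L2_closure f -> L2_closure g -> L2_closure (fun x => f x + g x)%R.
Proof.
move=> mf mg af ag e e0; have e4 : (0 < e / 4)%R by lra.
have [p sp fp] := af _ e4; have [q sq gq] := ag _ e4.
exists (fun x => p x + q x)%R; first exact: spanD.
have mp := cmeasurable_span sp; have mq := cmeasurable_span sq.
have := LsqD_lt mX (cmeasurableB mf mp) (cmeasurableB mg mq) fp gq.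
rewrite (_ : 2 * _ + 2 * _ = e)%R; last by field.
apply: le_lt_trans; rewrite le_eqVlt; apply/orP; left; apply/eqP/eq_Lsq => x _.
by rewrite opprD addrACA.
Qed.

(** Multiplication by a bounded h is continuous in L^2, so it preserves the closure as soon as it
    sends the span into the closure. *)
Lemma L2_closureM f h (C : R) : cmeasurable X f -> cmeasurable X h ->
  (forall x, X x -> (normc (h x) ^+ 2 <= C)%R) -> L2_closure f ->
  (forall p, span S u p -> L2_closure (fun x => h x * p x)%R) ->
  L2_closure (fun x => h x * f x)%R.
Proof.
move=> mf mh hC af hp; apply: L2_closure_closed; first exact: cmeasurableM.
move=> e e0.
(* C has no known sign when X is empty and may vanish; a positive bound is needed to divide e by
   it. *)
have C1 : (0 < `|C| + 1)%R by rewrite ltr_wpDl.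
have eC : (0 < e / (`|C| + 1))%R by rewrite divr_gt0.
have [p sp fp] := af _ eC; have mp := cmeasurable_span sp.
exists (fun x => h x * p x)%R; split; [exact: cmeasurableM|exact: hp|].
have -> : (fun x => h x * f x - h x * p x)%R = (fun x => h x * (f x - p x))%R.
  by apply/funext => x; rewrite mulrBr.
apply: (@le_lt_trans _ _ ((`|C| + 1)%:E * Lsq mu X (fun x => f x - p x)%R)).
  apply: LsqM_le => //; [exact: cmeasurableB|].
  move=> x Xx; apply: (le_trans (hC x Xx)).
  by apply: (le_trans (ler_norm C)); rewrite lerDl.
by rewrite -lte_pdivlMl// muleC -EFinM mulrC in fp *.
Qed.

Lemma L2_closureZ (c : R[i]) f : cmeasurable X f -> L2_closure f ->
  L2_closure (fun x => c * f x)%R.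
Proof.
move=> mf af; apply: (@L2_closureM f (fun=> c) (normc c ^+ 2)) => //.
by move=> p sp; apply: span_L2_closure; exact: spanZ.
Qed.

End L2_closure.

(** * Vandermonde systems on the unit circle *)

Section vandermonde.
Context {R : realType}.
Implicit Types (z v : R[i]) (p : {poly R[i]}).

(** The recursion follows p = p(z) + (X - z) q: the 1 bounds the constant p(z), 2 / delta is the
    growth of the values from p to q, and the last factor 2 counts the two coefficients of q that
    enter a coefficient of (X - z) q. *)
Fixpoint coef_const (delta : R) (n : nat) : R :=
  if n is m.+1 then 1 + 2 / delta * coef_const delta m * 2 else 0.

Lemma coef_const_ge0 delta n : 0 < delta -> 0 <= coef_const delta n.
Proof.
move=> d0; elim: n => //= n IHn.
by rewrite addr_ge0// mulr_ge0// mulr_ge0// divr_ge0// ltW.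
Qed.

(* A polynomial with n coefficients is controlled by its values at n
   delta-separated points of the unit circle: p(X) - p(z) = (X - z) q(X). *)
Lemma coef_le_values delta n p (z : nat -> R[i]) (B : R) : 0 < delta ->
  (size p <= n)%N ->
  (forall i, (i < n)%N -> normc (z i) = 1) ->
  (forall i j, (i < n)%N -> (j < n)%N -> i != j -> delta <= normc (z i - z j)) ->
  (forall i, (i < n)%N -> normc p.[z i] <= B) ->
  forall i, normc p`_i <= coef_const delta n * B.
Proof.
move=> d0; elim: n p B => [|n IHn] p B sp z1 zd pB i.
  by move: sp; rewrite leqn0 size_poly_eq0 => /eqP ->; rewrite coef0 Normc.normc0 mul0r.
have B0 : 0 <= B by apply: le_trans (pB 0%N _) => //; exact: normc_ge0.
have /factor_theorem[q pq] : root (p - (p.[z n])%:P) (z n).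
  by rewrite rootE hornerD hornerN hornerC subrr.
have sq : (size q <= n)%N.
  have [->|q0] := eqVneq q 0; first by rewrite size_poly0.
  have : (size (p - (p.[z n])%:P)%R <= n.+1)%N.
    rewrite (leq_trans (size_polyD _ _))// geq_max sp size_polyN.
    by rewrite (leq_trans (size_polyC_leq1 _)).
  by rewrite pq size_Mmonic ?monicXsubC// size_XsubC addn2.
have qB j : (j < n)%N -> normc q.[z j] <= 2 / delta * B.
  move=> jn.
  have /(congr1 (@normc R)) : p.[z j] - p.[z n] = q.[z j] * (z j - z n).
    by rewrite -[in RHS](hornerXsubC (z n) (z j)) -hornerM -pq hornerD hornerN hornerC.
  rewrite Normc.normcM => e.
  have dz : delta <= normc (z j - z n) by apply: zd; rewrite ?ltn_eqF ?ltnS// ltnW.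
  have : normc q.[z j] * delta <= 2 * B.
    apply: (@le_trans _ _ (normc q.[z j] * normc (z j - z n))).
      by rewrite ler_wpM2l// normc_ge0.
    rewrite -e; apply: (le_trans (le_normcD _ _)); rewrite normcN mulr2n mulrDl mul1r.
    by apply: lerD; apply: pB; rewrite ltnS// ltnW.
  by rewrite -ler_pdivlMr// mulrAC.
have cq := IHn q _ sq (fun i lt => z1 i (ltnW lt))
  (fun i j lt lt' => zd i j (ltnW lt) (ltnW lt')) qB.
have pE : p = (p.[z n])%:P + q * ('X - (z n)%:P) by rewrite -pq addrC subrK.
have -> : p`_i = (if i == 0%N then p.[z n] else 0) +
    ((if i == 0%N then 0 else q`_i.-1) - q`_i * z n).
  by rewrite {1}pE coefD coefC mulrBr coefB coefMX coefMC.
set c0 := if i == 0%N then p.[z n] else 0; set c1 := if i == 0%N then 0 else q`_i.-1.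
have c0B : normc c0 <= B.
  by rewrite /c0; case: ifP => _; [exact: pB|rewrite Normc.normc0].
have cc0 := coef_const_ge0 n d0.
have b0 : 0 <= coef_const delta n * (2 / delta * B).
  by rewrite mulr_ge0// mulr_ge0// divr_ge0// ltW.
have c1B : normc c1 <= coef_const delta n * (2 / delta * B).
  by rewrite /c1; case: ifP => _; [rewrite Normc.normc0|exact: cq].
have c2B : normc (q`_i * z n) <= coef_const delta n * (2 / delta * B).
  by rewrite Normc.normcM z1// mulr1; exact: cq.
apply: (le_trans (le_normcD _ _)).
apply: (le_trans (lerD c0B (le_normcD _ _))).
rewrite normcN /=; apply: (le_trans (lerD (lexx _) (lerD c1B c2B))).
by rewrite le_eqVlt; apply/orP; left; apply/eqP; ring.
Qed.

Lemma vandermonde_bounds (k : nat) (delta : R) : 0 < delta ->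
  exists A B : R, [/\ 0 < A, 0 < B &
   forall (z : 'I_k -> R[i]), (forall i, normc (z i) = 1) ->
   (forall i j, i != j -> delta <= normc (z i - z j)) ->
   forall G : 'I_k -> R[i],
     A * \sum_j normc (G j) ^+ 2 <=
       \sum_i normc (\sum_(j < k) z i ^+ j * G j) ^+ 2 /\
     \sum_i normc (\sum_(j < k) z i ^+ j * G j) ^+ 2 <= B * \sum_j normc (G j) ^+ 2].
Proof.
(* Each of the k unknowns is at most C sqrt(S), with S the sum of squared values, which gives k C^2;
   the added 1 keeps D positive even for k = 0. *)
move=> d0; pose C := coef_const delta k; pose D := k%:R * C ^+ 2 + 1.
have D0 : 0 < D by rewrite ltr_wpDl// mulr_ge0// sqr_ge0.
(* The upper constant takes one k from Cauchy-Schwarz in each row and one from the number of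
   rows. *)
exists D^-1, (k%:R * k%:R + 1); split.
- by rewrite invr_gt0.
- by rewrite ltr_wpDl// mulr_ge0.
move=> z z1 zd G.
have zX i j : normc (z i ^+ j) = 1.
  by elim: j => [|j IHj]; rewrite ?expr0 ?Normc.normc1// exprS Normc.normcM z1 IHj mulr1.
have G0 : 0 <= \sum_j normc (G j) ^+ 2 by apply: sumr_ge0 => j _; exact: sqr_ge0.
split.
  rewrite ler_pdivrMl//.
  pose v i := \sum_(j < k) z i ^+ j * G j; pose S := \sum_i normc (v i) ^+ 2.
  have S0 : 0 <= S by apply: sumr_ge0 => i _; exact: sqr_ge0.
  (* [coef_le_values] takes nodes indexed by nat; the default 0 is never read, as all its conditions
     concern indices below k. *)
  pose zz n := if insub n is Some i then z i else 0.
  pose g n := if insub n is Some i then G i else 0.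
  have zzE (i : 'I_k) : zz i = z i by rewrite /zz valK.
  have gE (i : 'I_k) : g i = G i by rewrite /g valK.
  pose p := \poly_(i < k) g i.
  have pz (i : 'I_k) : p.[zz i] = v i.
    rewrite horner_poly zzE; apply: eq_bigr => j _; by rewrite gE mulrC.
  have vB i : normc (v i) <= Num.sqrt S.
    rewrite -[leLHS]ger0_norm ?normc_ge0// -sqrtr_sqr ler_sqrt//.
    by rewrite /S (bigD1 i)//= lerDl sumr_ge0// => l _; exact: sqr_ge0.
  have Gp (j : 'I_k) : G j = p`_j by rewrite coef_poly ltn_ord gE.
  have GB j : normc (G j) <= C * Num.sqrt S.
    rewrite Gp; apply: (@coef_le_values delta k p zz) => //.
    - exact: size_poly.
    - by move=> l lk; rewrite -[l]/(val (Ordinal lk)) zzE.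
    - move=> l m lk mk lm; rewrite -[l]/(val (Ordinal lk)) -[m]/(val (Ordinal mk)).
      by rewrite !zzE; exact: zd.
    - by move=> l lk; rewrite -[l]/(val (Ordinal lk)) pz.
  have C0 : 0 <= C by exact: coef_const_ge0.
  apply: (@le_trans _ _ (\sum_(j < k) (C ^+ 2 * S))).
    apply: ler_sum => j _; rewrite -[S in leRHS]sqr_sqrtr// -exprMn.
    by rewrite lerXn2r// ?nnegrE ?normc_ge0// mulr_ge0// sqrtr_ge0.
  rewrite sumr_const card_ord -[leLHS]mulr_natl mulrA /D [leRHS]mulrDl mul1r.
  by rewrite lerDl.
have step i : normc (\sum_(j < k) z i ^+ j * G j) ^+ 2 <= k%:R * \sum_j normc (G j) ^+ 2.
  apply: (le_trans (sqr_normc_sum _)); rewrite ler_wpM2l//; apply: ler_sum => j _.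
  by rewrite Normc.normcM zX mul1r.
apply: (le_trans (ler_sum _ (fun i _ => step i))).
rewrite sumr_const card_ord -[leLHS]mulr_natl mulrA [leRHS]mulrDl mul1r.
by rewrite lerDl.
Qed.

(** The b_j are the coefficients of the Lagrange polynomial of the node [z i], found as row i of the
    inverse Vandermonde matrix. *)
Lemma vandermonde_interpolation (k : nat) (z : 'I_k -> R[i]) (i : 'I_k) :
  injective z ->
  exists b : 'I_k -> R[i], forall l, \sum_(j < k) z l ^+ j * b j = (l == i)%:R.
Proof.
move=> zinj; pose a := \row_j z j.
have Vu : Vandermonde k a \in unitmx.
  rewrite unitmxE det_Vandermonde unitfE; apply/prodf_neq0 => l _.
  apply/prodf_neq0 => m lm; rewrite !mxE subr_eq0; apply: contraTneq lm => /zinj ->.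
  by rewrite ltnn.
pose e : 'rV[R[i]]_k := delta_mx ord0 i.
exists (fun j => (e *m invmx (Vandermonde k a)) ord0 j) => l.
have /matrixP/(_ ord0 l) : e *m invmx (Vandermonde k a) *m Vandermonde k a = e.
  by rewrite mulmxKV.
rewrite mxE [in RHS]mxE eqxx/= => <-; apply: eq_bigr => j _.
by have -> : Vandermonde k a j l = z l ^+ j; [rewrite !mxE|rewrite mulrC].
Qed.

End vandermonde.

(** * Lattices and fundamental domains *)

Section fundamental_tiling.
Context {R : realType} {d : nat} (M : 'M[R]_d).
Hypothesis Munit : M \in unitmx.
Implicit Types (x w : 'cV[R]_d) (z : 'cV[int]_d).
Local Notation I := (fundamental_domain M).

Definition lattice_point z : 'cV[R]_d := M *m map_mx intr z.

Definition lattice_coord (i : 'I_d) x : R := (invmx M *m x) i ord0.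

Lemma lattice_pointP z : lattice M (lattice_point z).
Proof. by exists z. Qed.

Lemma lattice_point_inj : injective lattice_point.
Proof.
move=> z z' /(congr1 (mulmx (invmx M))); rewrite /lattice_point !mulKmx//.
move/matrixP => e; apply/matrixP => i j.
by have := e i j; rewrite !mxE => /intr_inj.
Qed.

Lemma lattice_coordB i x z :
  lattice_coord i (x - lattice_point z) = lattice_coord i x - (z i ord0)%:~R.
Proof. by rewrite /lattice_coord mulmxBr /lattice_point mulKmx// !mxE. Qed.

Lemma fundamental_domainE :
  I = [set x | forall i, - 2^-1 <= lattice_coord i x < 2^-1].
Proof.
apply/seteqP; split => [_ [y /= yI <-] i|x /= xI].
  by rewrite /lattice_coord mulKmx.
by exists (invmx M *m x) => //; rewrite mulKVmx.
Qed.

Lemma lattice_coordE x i : x i ord0 = \sum_j M i j * lattice_coord j x.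
Proof. by rewrite -[in LHS](mulKVmx Munit x) mxE. Qed.

Lemma measurable_lattice_coord i :
  measurable_fun setT (fun x : 'cV[R]_d => lattice_coord i x).
Proof.
under eq_fun do rewrite /lattice_coord mxE.
apply: measurable_sum => j; apply: measurable_funM => //.
exact: (measurable_cV_coord j).
Qed.

Lemma measurable_fundamental_domain : measurable I.
Proof.
rewrite fundamental_domainE (_ : [set _ | _] = \bigcap_(i in [set: 'I_d])
    (lattice_coord i @^-1` [set` `[- (2^-1 : R), 2^-1[])); last first.
  apply/seteqP; split=> x /= Ix i.
    by move=> _; rewrite /= in_itv/= Ix.
  by have := Ix i Logic.I; rewrite /= in_itv.
apply: fin_bigcap_measurable => // i _.
by rewrite -[X in measurable X]setTI; exact: measurable_lattice_coord.
Qed.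

Lemma lebesgue_measurable_fundamental_domain : lebesgue_measurable I.
Proof. by apply: borel_lebesgue_measurable; exact: measurable_fundamental_domain. Qed.

Lemma lebesgue_fundamental_domain_fin : (lebesgue R d I < +oo)%E.
Proof.
rewrite lebesgue_borelE; last exact: measurable_fundamental_domain.
(* On I the lattice coordinates are at most 1 in absolute value, so the sum of all |M i j| bounds
   every entry of x. *)
apply: le_lt_trans (borel_lebesgue_box d (\sum_i \sum_j `|M i j|)).
apply: le_measure; rewrite ?inE.
- exact: measurable_fundamental_domain.
- have := @measurable_cV_forall R d (fun=> [set y | `|y| <= \sum_i \sum_j `|M i j|]).
  apply => _; rewrite (_ : [set _ | _] = [set`
    `[- (\sum_i \sum_j `|M i j|), (\sum_i \sum_j `|M i j|)]])//.
  by apply/seteqP; split => x /=; rewrite in_itv/= ler_norml.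
move=> x; rewrite fundamental_domainE => xI i.
rewrite lattice_coordE; apply: (le_trans (ler_norm_sum _ _ _)).
rewrite [leRHS](bigD1 i)//= ler_wpDr//.
  by apply: sumr_ge0 => j _; exact: sumr_ge0.
apply: ler_sum => j _; rewrite normrM ler_piMr// ler_norml.
by have /andP[? ?] := xI j; apply/andP; split; lra.
Qed.

Lemma fundamental_domain_cover x : exists z, I (x - lattice_point z).
Proof.
(* Rounding to the nearest integer, with ties going up because I is closed at -1/2 and open at
   1/2. *)
exists (\col_i Num.floor (lattice_coord i x + 2^-1)).
rewrite fundamental_domainE => i /=; rewrite lattice_coordB mxE.
have /andP[] := floor_itv (lattice_coord i x + 2^-1).
by rewrite intrD1 => h1 h2; apply/andP; split; lra.
Qed.

Lemma fundamental_domain_inj x z z' :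
  I (x - lattice_point z) -> I (x - lattice_point z') -> z = z'.
Proof.
rewrite fundamental_domainE /= => xz xz'.
apply/matrixP => i j; rewrite !ord1.
move: (xz i) (xz' i); rewrite !lattice_coordB.
move: (z i _) (z' i _) (lattice_coord i x) => a b c /andP[a1 a2] /andP[b1 b2].
have ab : `|(a - b)%:~R| < (1 : R) by rewrite intrB ltr_norml; apply/andP; split; lra.
apply/eqP; rewrite -subr_eq0; move: ab; rewrite -intr_norm (ltr_int R _ 1).
by case: (a - b) => [[|n]|n].
Qed.

(** * Folding an integral onto the fundamental domain *)

Section fold.
Local Open Scope ereal_scope.
Local Notation L := (lebesgue_space R d).
Local Notation mu := (lebesgue R d).
Variables (X : set L) (F : L -> \bar R).
Hypotheses (mX : measurable X) (mF : measurable_fun X F) (F0 : forall x, 0 <= F x).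

Let FX : L -> \bar R := F \_ X.
Let mFX : measurable_fun setT FX.
Proof. exact/(measurable_restrictT _ _).1. Qed.
Let FX0 x : 0 <= FX x.
Proof. by rewrite /FX patchE; case: ifP. Qed.

(** Numbering the translates of I by nat turns the fiber sum into a series. [pickle_inv] answers
    only on actual codes, so each lattice vector is met exactly once and the cells are disjoint. *)
Let cell n : set L :=
  if (pickle_inv n : option 'cV[int]_d) is Some z then
    (fun x => (x - lattice_point z)%R) @^-1` I else set0.
Let shifted n (w : L) : \bar R :=
  if (pickle_inv n : option 'cV[int]_d) is Some z then
    FX (w + lattice_point z)%R else 0.

Let mI : measurable (I : set L).
Proof. exact: lebesgue_measurable_fundamental_domain. Qed.

Let mcell n : measurable (cell n).
Proof.
by rewrite /cell; case: pickle_inv => // z; exact: lebesgue_measurable_shift.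
Qed.

Let mshifted n : measurable_fun setT (shifted n).
Proof.
rewrite /shifted; case: pickle_inv => [z|]; last exact: measurable_cst.
have := measurableT_comp mFX (measurable_fun_shift (lattice_point z)).
exact.
Qed.

Let shifted0 n w : 0 <= shifted n w.
Proof. by rewrite /shifted; case: pickle_inv. Qed.

Lemma fold_seriesE w :
  \esum_(l in lattice_fiber M X w) F (l + w)%R = \sum_(n <oo) shifted n w.
Proof.
rewrite nneseries_esumT//.
pose Z := [set: 'cV[int]_d].
transitivity (\esum_(z in Z) FX (w + lattice_point z)%R).
  rewrite (@reindex_esum R _ _ [set z | X (lattice_point z + w)%R] _ lattice_point).
    rewrite esum_mkcond; apply: eq_esum => z _.
    have -> : (z \in [set z | X (lattice_point z + w)%R]) =
        ((lattice_point z + w)%R \in X) by apply/idP/idP; rewrite !inE.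
    by rewrite /FX patchE addrC.
  split=> [z Xz|z z' _ _ /lattice_point_inj//|l [[z _ <-] Xl]].
    by split => //; exact: lattice_pointP.
  by exists z.
transitivity (\esum_(n in pickle @` Z) shifted n w).
  rewrite (@esum_image R _ _ Z pickle (shifted^~ w)).
    by apply: eq_esum => z _; rewrite /shifted pickleK_inv.
  by move=> z z' _ _ /(pcan_inj pickleK).
rewrite esum_mkcond; apply: eq_esum => n _; case: ifPn => // nZ.
rewrite /shifted; case E: (pickle_inv n) => [z|//].
case/negP: nZ; rewrite inE; exists z => //.
by have := pickle_invK (T := 'cV[int]_d) n; rewrite /oapp E.
Qed.

Lemma measurable_fold : measurable_fun setT (fun w : L =>
  \esum_(l in lattice_fiber M X w) F (l + w)%R).
Proof.
under eq_fun do rewrite fold_seriesE.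
by apply: ge0_emeasurable_sum => n; [move=> *; exact: shifted0|move=> _; exact: mshifted].
Qed.

Let shift_cell z : (fun w : L => (w + lattice_point z)%R) @^-1`
  ((fun x => (x - lattice_point z)%R) @^-1` I) = I.
Proof. by apply/seteqP; split=> x /=; rewrite addrK. Qed.

(** The translates of I partition the space; translation invariance brings each piece of the
    integral back to I, and nonnegativity allows the exchange of sum and integral. *)
Lemma integral_fold : \int[mu]_(x in X) F x =
  \int[mu]_(w in (I : set L)) \esum_(l in lattice_fiber M X w) F (l + w)%R.
Proof.
under [RHS]eq_integral do rewrite fold_seriesE.
rewrite integral_nneseries//; last by move=> n; apply: (measurable_funS _ _ (mshifted n)).
have -> : \int[mu]_(x in X) F x = \int[mu]_x FX x by rewrite integral_mkcond.
have cells : \bigcup_n cell n = setT.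
  apply/seteqP; split=> // x _; have [z xz] := fundamental_domain_cover x.
  by exists (pickle z) => //; rewrite /cell pickleK_inv.
rewrite -[in LHS]cells ge0_integral_bigcup//; last 2 first.
- by rewrite cells.
- apply/trivIsetP => m n _ _ mn; apply/seteqP; split=> // x [].
  rewrite /cell; case E: (pickle_inv m) => [z|//]; case E': (pickle_inv n) => [z'|//].
  move=> xz xz'; have zz' : z = z' by exact: fundamental_domain_inj xz xz'.
  have pm := pickle_invK (T := 'cV[int]_d) m; rewrite /oapp E in pm.
  have pn := pickle_invK (T := 'cV[int]_d) n; rewrite /oapp E' in pn.
  by move: mn; rewrite -pm -pn zz' eqxx.
apply: eq_eseriesr => n _; rewrite /cell /shifted.
case: pickle_inv => [z|]; last by rewrite integral_set0 integral0.
rewrite -(@ge0_integral_shift R d (lattice_point z)) ?shift_cell//.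
- exact: lebesgue_measurable_shift.
- exact: (measurable_funS _ _ mFX).
Qed.

End fold.

(** If I were null, folding the constant 1 would give measure 0 to the whole space. *)
Lemma lebesgue_fundamental_domain_gt0 : (0 < lebesgue R d I)%E.
Proof.
rewrite lt_neqAle measure_ge0 andbT; apply/eqP => I0.
have := @integral_fold setT (cst 1%E) measurableT (measurable_cst _) (fun=> lee01).
rewrite integral_cst// mul1e => e.
have := @borel_lebesgueT_gt0 R d; rewrite -lebesgue_borelE//.
move: e => ->; rewrite lt_neqAle => /andP[/eqP[]]; apply/esym.
pose f1 (w : lebesgue_space R d) : \bar R :=
  \esum_(l in lattice_fiber M [set: lebesgue_space R d] w) cst 1%E (l + w)%R.
have mf1 : measurable_fun [set: lebesgue_space R d] f1.
  exact: (@measurable_fold setT (cst 1%E) measurableT (measurable_cst _) (fun=> lee01)).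
have mI := lebesgue_measurable_fundamental_domain.
exact: (@null_set_integral _ (lebesgue_space R d) R (lebesgue R d) I f1 mI
  (measurable_funS measurableT (@subsetT _ _) mf1) (esym I0)).
Qed.

End fundamental_tiling.

Lemma integrable_bounded {R : realType} dd (T : measurableType dd)
    (mu : {measure set T -> \bar R}) (X : set T) (f : T -> R) (K : R) :
  measurable X -> (mu X < +oo)%E -> measurable_fun X f ->
  (forall x, X x -> `|f x| <= K) -> mu.-integrable X (EFin \o f).
Proof.
move=> mX Xoo mf fK; apply: measurable_bounded_integrable => //.
by exists K; split; rewrite ?num_real// => N KN x Xx; exact: le_trans (fK x Xx) (ltW KN).
Qed.

(** * Exponentials *)

Section expo.
Context {R : realType} {d : nat}.
Implicit Types (a b x y l : 'cV[R]_d).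

Lemma dotDl a b x : dot (a + b) x = dot a x + dot b x.
Proof. by rewrite /dot -big_split; apply: eq_bigr => i _; rewrite mxE mulrDl. Qed.

Lemma dotDr a x y : dot a (x + y) = dot a x + dot a y.
Proof. by rewrite /dot -big_split; apply: eq_bigr => i _; rewrite mxE mulrDr. Qed.

Lemma dotNl a x : dot (- a) x = - dot a x.
Proof. by rewrite /dot -sumrN; apply: eq_bigr => i _; rewrite mxE mulNr. Qed.

Lemma dotZr (c : R) a x : dot a (c *: x) = c * dot a x.
Proof. by rewrite /dot mulr_sumr; apply: eq_bigr => i _; rewrite mxE mulrCA. Qed.

Lemma dot_eq0 a : dot a a = 0 -> a = 0.
Proof.
move=> aa0; apply/matrixP => i j; rewrite ord1 mxE; apply/eqP.
have : \sum_(i < d) a i ord0 * a i ord0 == 0 by apply/eqP.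
rewrite psumr_eq0 => [/allP/(_ i)|k _]; last by rewrite -expr2 sqr_ge0.
by rewrite mem_index_enum => /(_ isT)/=; rewrite mulf_eq0 orbb.
Qed.

Lemma expoDl a b x : expo (a + b) x = expo a x * expo b x.
Proof.
rewrite /expo dotDl mulrDr cosD sinD; apply/eqP; rewrite eq_complex /=.
by apply/andP; split; apply/eqP; ring.
Qed.

Lemma expoDr a x y : expo a (x + y) = expo a x * expo a y.
Proof.
rewrite /expo dotDr mulrDr cosD sinD; apply/eqP; rewrite eq_complex /=.
by apply/andP; split; apply/eqP; ring.
Qed.

Lemma expo0 x : expo 0 x = 1.
Proof.
have d0 : dot 0 x = 0 by rewrite /dot big1// => i _; rewrite mxE mul0r.
by apply/eqP; rewrite eq_complex /= d0 mulr0 cos0 sin0 !eqxx.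
Qed.

Lemma normc_expo a x : normc (expo a x) = 1.
Proof. by rewrite /normc/= cos2Dsin2 sqrtr1. Qed.

Lemma expoNK a x : expo (- a) x * expo a x = 1.
Proof. by rewrite -expoDl addNr expo0. Qed.

Lemma conj_expo a x : ((expo a x)^*)%C = expo (- a) x.
Proof. by rewrite /expo/= dotNl mulrN cosN sinN. Qed.

Lemma expo_natmul (j : nat) a x : expo (a *+ j) x = expo a x ^+ j.
Proof. by elim: j => [|j IHj]; rewrite ?mulr0n ?expo0// mulrS expoDl IHj exprS. Qed.

Lemma cos_sin_2piz (n : int) : cos (2 * pi * n%:~R) = 1 :> R /\ sin (2 * pi * n%:~R) = 0 :> R.
Proof.
have nat_case (m : nat) : cos (2 * pi * m%:R) = 1 :> R /\ sin (2 * pi * m%:R) = 0 :> R.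
  elim: m => [|m [IHc IHs]]; first by rewrite mulr0 cos0 sin0.
  have -> : 2 * pi * m.+1%:R = 2 * pi * m%:R + pi *+ 2 :> R.
    by rewrite -natr1 mulr2n; ring.
  by rewrite cosD2pi sinD2pi.
case: n => m; first exact: nat_case.
by rewrite NegzE rmorphN/= mulrN cosN sinN; have [-> ->] := nat_case m.+1; rewrite oppr0.
Qed.

Variable M : 'M[R]_d.

Lemma expo_dual h l : dual_lattice M h -> lattice M l -> expo h l = 1.
Proof.
move=> hH /hH /intrP[n hn]; rewrite /expo hn.
by have [-> ->] := cos_sin_2piz n; apply/eqP; rewrite eq_complex/= !eqxx.
Qed.

Lemma dual_lattice0 : dual_lattice M 0.
Proof.
move=> l _; rewrite (_ : dot 0 l = 0) ?rpred0//.
by rewrite /dot big1// => i _; rewrite mxE mul0r.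
Qed.

Lemma dual_latticeD h h' :
  dual_lattice M h -> dual_lattice M h' -> dual_lattice M (h + h').
Proof. by move=> hH hH' l ll; rewrite dotDl rpredD; [|exact: hH|exact: hH']. Qed.

Lemma dual_latticeN h : dual_lattice M h -> dual_lattice M (- h).
Proof. by move=> hH l ll; rewrite dotNl rpredN; exact: hH. Qed.

Lemma lebesgue_measurable_fun (f : 'cV[R]_d -> R) :
  measurable_fun [set: 'cV[R]_d] f -> measurable_fun [set: lebesgue_space R d] f.
Proof.
move=> mf _ Y mY; apply: borel_lebesgue_measurable; exact: mf.
Qed.

Lemma measurable_dot a : measurable_fun [set: 'cV[R]_d] (dot a).
Proof.
apply: measurable_sum => i; apply: measurable_funM => //.
exact: (measurable_cV_coord i).
Qed.

Lemma cmeasurable_expo a : cmeasurable [set: lebesgue_space R d] (expo a).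
Proof.
have m2 : measurable_fun [set: 'cV[R]_d] (fun x => 2 * pi * dot a x).
  by apply: measurable_funM => //; exact: measurable_dot.
split; apply: lebesgue_measurable_fun => /=.
  by apply: measurableT_comp => //; apply: continuous_measurable_fun; exact: continuous_cos.
by apply: measurableT_comp => //; apply: continuous_measurable_fun; exact: continuous_sin.
Qed.

End expo.

(** * Orthogonality of the dual exponentials and Parseval *)

Section orthogonality.
Context {R : realType} {d : nat} (M : 'M[R]_d).
Hypothesis Munit : M \in unitmx.
Local Notation L := (lebesgue_space R d).
Local Notation mu := (lebesgue R d).
Local Notation I := (fundamental_domain M).

Let mI : measurable (I : set L).
Proof. exact: lebesgue_measurable_fundamental_domain. Qed.

Let muI : (mu I < +oo)%E.
Proof. exact: lebesgue_fundamental_domain_fin. Qed.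

Lemma lattice_pointN z : lattice_point M (- z) = - lattice_point M z.
Proof. by rewrite /lattice_point map_mxN mulmxN. Qed.

Lemma lebesgue_measurable_cell l : lebesgue_measurable ((fun x => x - l) @^-1` I).
Proof. exact: lebesgue_measurable_shift. Qed.

(** The translate I + t meets every coset of the lattice exactly once. Folding the integral over it
    back onto I thus yields one-term fiber sums, equal to F w by periodicity. *)
Lemma ge0_integral_periodic_shift (t : 'cV[R]_d) (F : L -> \bar R) :
  measurable_fun setT F -> (forall x, (0 <= F x)%E) ->
  (forall l w, lattice M l -> F (l + w) = F w) ->
  (\int[mu]_(w in (I : set L)) F (w + t)%R = \int[mu]_(w in (I : set L)) F w)%E.
Proof.
move=> mF F0 Fper.
have sE : (fun x => x + t) @^-1` ((fun x => x - t) @^-1` I) = I.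
  by apply/seteqP; split=> x /=; rewrite addrK.
rewrite -[X in (\int[_]_(_ in X) _ = _)%E]sE ge0_integral_shift//; last 2 first.
- exact: lebesgue_measurable_cell.
- exact: (measurable_funS measurableT (@subsetT _ _) mF).
rewrite (integral_fold Munit)//; last 2 first.
- exact: lebesgue_measurable_cell.
- exact: (measurable_funS measurableT (@subsetT _ _) mF).
apply: eq_integral => w _.
have [z zI] := fundamental_domain_cover Munit (w - t).
rewrite (_ : lattice_fiber _ _ _ = [set - lattice_point M z]).
  rewrite esum_set1// Fper// -lattice_pointN; exact: lattice_pointP.
apply/seteqP; split=> [_ [[z' _ <-] /= Iz]|_ ->]; last first.
  split; first by rewrite -lattice_pointN; exact: lattice_pointP.
  by rewrite /= -addrA addrC.
have -> : z' = - z.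
  apply/eqP; rewrite -eqr_oppLR; apply/eqP.
  apply: (@fundamental_domain_inj _ _ _ Munit (w - t)) => //.
  by rewrite lattice_pointN opprK addrC addrA.
exact: lattice_pointN.
Qed.

Let integrable_fd (f : L -> R) (K : R) : measurable_fun setT f ->
  (forall x, `|f x| <= K) -> mu.-integrable (I : set L) (EFin \o f).
Proof.
move=> mf fK.
exact: (@integrable_bounded R _ L mu I f K mI muI
  (measurable_funS measurableT (@subsetT _ _) mf) (fun x _ => fK x)).
Qed.

Let measurable_trig (g : R -> R) (h : 'cV[R]_d) : measurable_fun setT g ->
  measurable_fun [set: L] (fun w : L => g (2 * pi * dot h w)).
Proof.
move=> mg; apply: lebesgue_measurable_fun.
have mh : measurable_fun [set: 'cV[R]_d] (fun w => 2 * pi * dot h w).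
  by apply: measurable_funM; [exact: measurable_cst|exact: measurable_dot].
exact: (measurableT_comp mg mh).
Qed.

Let integrable_trig (g : R -> R) (c : R) (h : 'cV[R]_d) : measurable_fun setT g ->
  (forall x, `|g x| <= 1) ->
  mu.-integrable (I : set L) (EFin \o (fun w : L => c * g (2 * pi * dot h w))).
Proof.
move=> mg g1; apply: (@integrable_fd _ `|c|).
  by apply: measurable_funM; [exact: measurable_cst|exact: measurable_trig].
by move=> x; rewrite normrM ler_piMr.
Qed.

(** The integral is unchanged by a shift that reverses the sign of the integrand. Abstracting over g
    treats cosine and sine at once. *)
Lemma integral_alternating (g : R -> R) (h : 'cV[R]_d) :
  measurable_fun setT g -> (forall x, `|g x| <= 1) ->
  (forall x, g (x + pi) = - g x) ->
  dual_lattice M h -> h != 0 ->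
  (\int[mu]_(w in (I : set L)) (g (2 * pi * dot h w))%:E = 0)%E.
Proof.
move=> mg g1 gpi hH h0.
have gper : forall x, g (x + pi *+ 2) = g x.
  by move=> x; rewrite mulr2n addrA !gpi opprK.
have gz (n : int) x : g (2 * pi * n%:~R + x) = g x.
  have gn (m : nat) y : g (y + 2 * pi * m%:R) = g y.
    elim: m => [|m IHm]; first by rewrite mulr0 addr0.
    have -> : 2 * pi * m.+1%:R = 2 * pi * m%:R + pi *+ 2 :> R.
      by rewrite -natr1 mulr2n; ring.
    by rewrite addrA gper.
  case: n => m; first by rewrite addrC gn.
  by rewrite NegzE rmorphN/= mulrN addrC -[LHS](gn m.+1) subrK.
(* Half a period along h: [dot h t] is 1/2, so the argument of g moves by pi. *)
pose t := (2 * dot h h)^-1 *: h.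
have hh : dot h h != 0 by apply: contra_neq h0; exact: dot_eq0.
have ht : 2 * pi * dot h t = pi by rewrite dotZr; field.
have mgh := @measurable_trig g h mg.
pose G (w : L) := g (2 * pi * dot h w).
have Gt w : G (w + t) = - G w by rewrite /G dotDr mulrDr ht gpi.
have iG : mu.-integrable (I : set L) (EFin \o G).
  by apply: (@integrable_fd _ 1) => // x; exact: g1.
have i1 : mu.-integrable (I : set L) (EFin \o (cst (1 : R))).
  apply: (@integrable_fd _ 1); first exact: measurable_cst.
  by move=> x; rewrite normr1.
have G1 w : (0 <= (1 + G w)%:E)%E.
  by rewrite lee_fin; have := g1 (2 * pi * dot h w); rewrite -/(G w) ler_norml; lra.
(* Invariance is available for nonnegative functions, hence 1 + G; comparing the integrals of 1 - G
   and 1 + G leaves that of G equal to 0. *)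
have := @ge0_integral_periodic_shift t (fun w => (1 + G w)%:E) _ G1 _.
move=> /(_ _ _)/wrap[|l w ll|].
- by apply/measurable_EFinP; exact: measurable_funD.
- rewrite /G dotDr mulrDr; have /intrP[n ->] := hH _ ll; by rewrite gz.
move=> e.
have {e} : (\int[mu]_(w in (I : set L)) ((1 : R)%:E - (G w)%:E) =
  \int[mu]_(w in (I : set L)) ((1 : R)%:E + (G w)%:E))%E.
  by rewrite -[RHS]e; apply: eq_integral => w _; rewrite Gt.
rewrite integralB// integralD// => e.
have fG := integrable_fin_num mI iG.
have f1 := integrable_fin_num mI i1.
rewrite -(fineK fG); congr (_%:E).
move: e; rewrite -(fineK fG) -(fineK f1) -EFinB -EFinD => -[] e.
by lra.
Qed.

Let measurable_cosR : measurable_fun setT (@cos R).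
Proof. apply: continuous_measurable_fun; exact: continuous_cos. Qed.

Let measurable_sinR : measurable_fun setT (@sin R).
Proof. apply: continuous_measurable_fun; exact: continuous_sin. Qed.

Let Re_expoE (c : R[i]) (h w : 'cV[R]_d) : complex.Re (c * expo h w) =
  complex.Re c * cos (2 * pi * dot h w) + - complex.Im c * sin (2 * pi * dot h w).
Proof. by rewrite complex_ReM mulNr. Qed.

Let integrable_Re (c : R[i]) h :
  mu.-integrable (I : set L) (EFin \o (fun w => complex.Re (c * expo h w))).
Proof.
rewrite (_ : _ \o _ =
  ((EFin \o (fun w : L => (complex.Re c * cos (2 * pi * dot h w))%R)) \+
  (EFin \o (fun w : L => (- complex.Im c * sin (2 * pi * dot h w))%R)))%E); last first.
  by apply/funext => w; rewrite /= Re_expoE EFinD.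
exact: (integrableD mI (integrable_trig _ _ measurable_cosR (@cos_max R))
  (integrable_trig _ _ measurable_sinR (@sin_max R))).
Qed.

Lemma integral_Re_expo (c : R[i]) h : dual_lattice M h ->
  (\int[mu]_(w in (I : set L)) (complex.Re (c * expo h w))%:E =
   (if h == 0 then complex.Re c else 0)%:E * mu I)%E.
Proof.
move=> hH; case: eqP => [->|/eqP h0].
  under eq_integral do rewrite expo0 mulr1.
  by rewrite integral_cst.
rewrite mul0e.
under eq_integral do rewrite Re_expoE EFinD.
have ic := @integrable_trig _ (complex.Re c) h measurable_cosR (@cos_max R).
have isn := @integrable_trig _ (- complex.Im c) h measurable_sinR (@sin_max R).
rewrite [LHS](integralD mI ic isn).
have int0 (g : R -> R) (c' : R) : measurable_fun setT g -> (forall x, `|g x| <= 1) ->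
    (forall x, g (x + pi) = - g x) ->
    (\int[mu]_(x in (I : set L)) (c' * g (2 * pi * dot h x))%:E = 0)%E.
  move=> mg g1 gpi; under eq_integral do rewrite EFinM.
  have i1 : mu.-integrable (I : set L) (EFin \o (fun w : L => g (2 * pi * dot h w))).
    by apply: (@integrable_fd _ 1); [exact: measurable_trig|move=> x; exact: g1].
  by rewrite (integralZl mI i1) integral_alternating// mule0.
by rewrite [X in (X + _)%E](int0 _ _ measurable_cosR (@cos_max R) (@cosDpi R))
  [X in (_ + X)%E](int0 _ _ measurable_sinR (@sin_max R) (@sinDpi R)) adde0.
Qed.

Lemma integral_Re_expo_sum (I0 : eqType) (r : seq I0) (c : I0 -> R[i])
    (h : I0 -> 'cV[R]_d) : (forall a, a \in r -> dual_lattice M (h a)) ->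
  (\int[mu]_(w in (I : set L)) (complex.Re (\sum_(a <- r) c a * expo (h a) w))%:E =
   (\sum_(a <- r | h a == 0%R) complex.Re (c a))%:E * mu I)%E.
Proof.
suff : (forall a, a \in r -> dual_lattice M (h a)) ->
   mu.-integrable (I : set L)
     (EFin \o (fun w => complex.Re (\sum_(a <- r) c a * expo (h a) w))) /\
  (\int[mu]_(w in (I : set L)) (complex.Re (\sum_(a <- r) c a * expo (h a) w))%:E =
   (\sum_(a <- r | h a == 0%R) complex.Re (c a))%:E * mu I)%E.
  by move=> + hH => /(_ hH)[].
elim: r => [|a r IHr] hH.
  split; last by under eq_integral do rewrite big_nil; rewrite big_nil mul0e integral0.
  rewrite (_ : _ \o _ = cst 0%E); first exact: integrable0.
  by apply/funext => w; rewrite /= big_nil.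
have [i1 e1] : _ /\ _ := IHr (fun b (br : b \in r) => hH b (@mem_behead _ (a :: r) b br)).
have ha := hH a (mem_head _ _).
have sumE : EFin \o (fun w => complex.Re (\sum_(a <- a :: r) c a * expo (h a) w)) =
  ((EFin \o (fun w => complex.Re (c a * expo (h a) w)%R)) \+
   (EFin \o (fun w => complex.Re (\sum_(a <- r) c a * expo (h a) w)%R)))%E.
  by apply/funext => w; rewrite /= big_cons raddfD/= EFinD.
split; first by rewrite sumE; exact: (integrableD mI (integrable_Re _ _) i1).
rewrite -[LHS]/(\int[mu]_(w in (I : set L))
  (EFin \o (fun w => complex.Re (\sum_(a <- a :: r) c a * expo (h a) w)%R)) w)%E.
rewrite sumE (integralD mI (integrable_Re _ _) i1) e1 integral_Re_expo// big_cons.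
case: ifP => _; last by rewrite mul0e add0e.
have muf : mu I \is a fin_num by rewrite ge0_fin_numE.
by rewrite -(fineK muf) -!EFinM -EFinD mulrDl.
Qed.

(** The squared modulus is the real part of a double sum of exponentials of frequencies h - h' in
    the dual lattice; after integration only the diagonal remains, which is why integrals of real
    parts suffice. *)
Lemma Lsq_trig (s : seq 'cV[R]_d) (c : 'cV[R]_d -> R[i]) : uniq s ->
  (forall h, h \in s -> dual_lattice M h) ->
  (Lsq mu (I : set L) (fun w => \sum_(h <- s) c h * expo h w)%R =
   (\sum_(h <- s) normc (c h) ^+ 2)%:E * mu I)%E.
Proof.
move=> us sH; pose r := [seq (h, h') | h <- s, h' <- s].
have sqE (z : R[i]) : normc z ^+ 2 = complex.Re (z * (z^*)%C).
  by case: z => a b; rewrite sqr_normcE /= mulrN opprK !expr2.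
have conjM (z z' : R[i]) : ((z * z')^*)%C = ((z^*)%C * (z'^*)%C).
  by case: z z' => [a b] [a' b']; apply/eqP; rewrite eq_complex/=;
    apply/andP; split; apply/eqP; ring.
rewrite /Lsq.
transitivity (\int[mu]_(w in (I : set L)) (complex.Re (\sum_(a <- r)
    (c a.1 * ((c a.2)^*)%C) * expo (a.1 - a.2) w))%:E)%E.
  apply: eq_integral => w _; rewrite sqE; congr (complex.Re _)%:E.
  rewrite big_allpairs_dep/= mulr_suml; apply: eq_bigr => h _.
  rewrite rmorph_sum/= mulr_sumr; apply: eq_bigr => h' _.
  by rewrite conjM conj_expo expoDl; ring.
rewrite integral_Re_expo_sum; last first.
  move=> _ /allpairsP[[h h'] /= [hs h's ->]] /=.
  by apply: dual_latticeD; [exact: sH|apply: dual_latticeN; exact: sH].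
congr (_%:E * _)%E; rewrite big_mkcond big_allpairs_dep/=.
rewrite !big_seq; apply: eq_bigr => h hs.
rewrite (bigD1_seq h)//= subrr eqxx big1 ?addr0 ?sqE// => h' h'h.
by rewrite subr_eq0 eq_sym (negbTE h'h).
Qed.

End orthogonality.

(** * Density of trigonometric polynomials *)

Section bounded_algebra.
Context {R : realType} {T : Type}.
Variable B : (T -> R) -> Prop.
Hypotheses (Bcst : forall c, B (fun=> c))
  (BD : forall u v, B u -> B v -> B (fun x => u x + v x))
  (BM : forall u v, B u -> B v -> B (fun x => u x * v x))
  (Bbnd : forall u, B u -> exists C, forall x, `|u x| <= C)
  (Blim : forall (u_ : (T -> R)^nat) u (C : R), (forall n, B (u_ n)) ->
    (forall n x, `|u_ n x| <= C) -> (forall x, u_ n x @[n --> \oo] --> u x) -> B u).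
Implicit Types u v : T -> R.

Let BZ c u : B u -> B (fun x => c * u x).
Proof. by move=> Bu; apply: BM. Qed.

Let BX u n : B u -> B (fun x => u x ^+ n).
Proof.
move=> Bu; elim: n => [|n IHn]; first by under eq_fun do rewrite expr0; exact: Bcst.
by under eq_fun do rewrite exprS; exact: BM.
Qed.

Let Bbnd1 u : B u -> exists2 C : R, 0 < C & forall x, `|u x| <= C.
Proof.
move=> /Bbnd[C uC]; exists (`|C| + 1); first by rewrite ltr_wpDl.
by move=> x; rewrite (le_trans (uC x))// (le_trans (ler_norm _))// lerDl.
Qed.

(* |v| is the increasing limit of p_0 = 0, p_(n+1) = p_n + (v^2 - p_n^2) / 2
   when |v| <= 1. *)
Lemma bounded_algebra_norm u : B u -> B (fun x => `|u x|).
Proof.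
move=> Bu; have [C C0 uC] := Bbnd1 Bu.
pose v x := C^-1 * u x.
have Bv : B v by exact: BZ.
have v1 x : `|v x| <= 1.
  by rewrite normrM gtr0_norm ?invr_gt0// ler_pdivrMl// mulr1.
pose p n x : R := iter n (fun a : R => a + 2^-1 * (v x ^+ 2 + -1 * a ^+ 2)) 0.
have Bp n : B (p n).
  elim: n => [|n IHn] /=; first exact: Bcst.
  by apply: BD => //; apply: BZ; apply: BD; [exact: BX|apply: BZ; exact: BX].
(* With a = |v|, q = p_n and q' the next iterate, a - q' = (a - q) (1 - (a + q) / 2), and q >= 0
   bounds the last factor by 1 - a / 2: the error decays geometrically. *)
have step (a q c : R) : 0 <= q <= a -> a <= 1 -> 0 <= c -> a - q <= a * c ->
    0 <= q + 2^-1 * (a ^+ 2 + -1 * q ^+ 2) <= a /\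
    a - (q + 2^-1 * (a ^+ 2 + -1 * q ^+ 2)) <= a * c * (1 - a / 2).
  move=> /andP[q0 qa] a1 c0 qc.
  have eq' : a - (q + 2^-1 * (a ^+ 2 + -1 * q ^+ 2)) = (a - q) * (1 - (a + q) / 2) by field.
  have aq0 : 0 <= a - q by rewrite subr_ge0.
  have f0 : 0 <= 1 - (a + q) / 2 by lra.
  split; last first.
    by rewrite eq'; apply: ler_pM => //; lra.
  apply/andP; split; last by rewrite -subr_ge0 eq' mulr_ge0.
  have : q ^+ 2 <= a ^+ 2 by rewrite lerXn2r// nnegrE (le_trans q0).
  by move=> ?; lra.
have pbnd n x : 0 <= p n x <= `|v x| /\ `|v x| - p n x <= `|v x| * (1 - `|v x| / 2) ^+ n.
  have v0 := normr_ge0 (v x); have := v1 x.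
  elim: n => [|n IHn] v1x.
    by rewrite -[p 0%N x]/(0 : R) expr0 mulr1 subr0 !lexx v0.
  rewrite -[p n.+1 x]/(p n x + 2^-1 * (v x ^+ 2 + -1 * p n x ^+ 2)).
  rewrite -[v x ^+ 2](real_normK (num_real (v x))).
  have [qb qn] := IHn v1x.
  have c0 : 0 <= (1 - `|v x| / 2) ^+ n.
    by rewrite exprn_ge0// subr_ge0 ler_pdivrMr// mul1r (le_trans v1x)// ler1n.
  by rewrite (exprSr _ n) [ `|v x| * (_ * _)]mulrA; exact: (step _ _ _ qb v1x c0 qn).
have cvp x : p n x @[n --> \oo] --> `|v x|.
  (* At v = 0 the geometric ratio is 1, but there the sequence is constantly 0. *)
  have [v0|v0] := eqVneq (v x) 0.
    rewrite v0 normr0 (_ : (fun n => p n x) = cst 0); first exact: cvg_cst.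
    apply/funext => n; have [/andP[p0 pv] _] := pbnd n x.
    by apply/eqP; rewrite eq_le p0 andbT (le_trans pv)// v0 normr0.
  have cg : `|v x| * (1 - `|v x| / 2) ^+ n @[n --> \oo] --> (0 : R).
    rewrite -[X in _ --> X](mulr0 `|v x|); apply: cvgM; first exact: cvg_cst.
    apply: cvg_expr; have := v1 x; have : 0 < `|v x| by rewrite normr_gt0.
    by move=> h1 h2; rewrite ltr_norml; apply/andP; split; lra.
  have : (fun n => `|v x| - `|v x| * (1 - `|v x| / 2) ^+ n) @ \oo --> `|v x|.
    by rewrite -[X in _ --> X]subr0; apply: cvgB => //; exact: cvg_cst.
  move=> h; apply: (squeeze_cvgr _ h); last exact: cvg_cst.
  by apply: nearW => n; have [/andP[_ ->] h'] := pbnd n x; rewrite andbT lerBlDr addrC -lerBlDr.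
have Bav : B (fun x => `|v x|).
  apply: (Blim (C := 1) Bp _ cvp) => n x.
  by have [/andP[p0 pv] _] := pbnd n x; rewrite ger0_norm// (le_trans pv).
have -> : (fun x => `|u x|) = (fun x => C * `|v x|).
  by apply/funext => x; rewrite normrM gtr0_norm ?invr_gt0// mulVKf// gt_eqF.
exact: BZ.
Qed.

(** The rescaled positive part w of u takes values in [0, 1] and is positive exactly where u is, so
    1 - (1 - w)^n tends boundedly to the indicator. *)
Lemma bounded_algebra_gt0 u : B u -> B (\1_[set x | 0 < u x]).
Proof.
move=> Bu; have [C C0 uC] := Bbnd1 Bu.
pose w x := (2 * C)^-1 * (u x + `|u x|).
have Bw : B w by apply: BZ; apply: BD => //; exact: bounded_algebra_norm.
have C20 : 0 < 2 * C by rewrite mulr_gt0.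
have w01 x : 0 <= w x <= 1.
  rewrite /w ler_pdivrMl// mulr1 mulr_ge0 ?invr_ge0 ?(ltW C20)//=.
    by have := uC x; have := ler_norm (u x); lra.
  by have := ler_norm (- u x); rewrite normrN; lra.
apply: (Blim (u_ := fun n x => 1 + -1 * (1 + -1 * w x) ^+ n) (C := 1)) => [n|n x|x].
- apply: BD => //; apply: BZ; apply: BX; apply: BD => //; exact: BZ.
- have : 0 <= (1 + -1 * w x) ^+ n <= 1.
    have /andP[w0 w1] := w01 x.
    by rewrite exprn_ge0 ?exprn_ile1//; lra.
  by move=> /andP[? ?]; rewrite ger0_norm; lra.
rewrite indicE; have [ux|ux] := ltP 0 (u x).
  rewrite mem_set//= (_ : 1%:R = 1 + -1 * 0 :> R); last by rewrite mulr0 addr0.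
  apply: cvgD; first exact: cvg_cst.
  apply: cvgM; first exact: cvg_cst.
  apply: cvg_expr; have /andP[w0 w1] := w01 x.
  have wp : 0 < w x by rewrite mulr_gt0 ?invr_gt0// gtr0_norm// addr_gt0.
  by rewrite ltr_norml; apply/andP; split; lra.
rewrite memNset/=; last by rewrite /mkset ltNge ux.
have -> : w x = 0 by rewrite /w ler0_norm// subrr mulr0.
under eq_fun do rewrite mulr0 addr0 expr1n mulN1r subrr.
exact: cvg_cst.
Qed.

Lemma bounded_algebra_indicI A A' : B \1_A -> B \1_A' -> B (\1_(A `&` A')).
Proof. by move=> BA BA'; rewrite indicI; exact: BM. Qed.

Lemma bounded_algebra_indicC A : B \1_A -> B (\1_(~` A)).
Proof.
move=> BA; have -> : (\1_(~` A) : T -> R) = fun x => 1 + -1 * \1_A x.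
  by apply/funext => x; rewrite !indicE in_setC; case: (x \in A) => /=; lra.
by apply: BD => //; exact: BZ.
Qed.

(** The partial products of the 1 - \1_(A i) tend boundedly to the indicator of the complement of
    the union. *)
Lemma bounded_algebra_bigcup (A : (set T)^nat) :
  (forall n, B (\1_(A n))) -> B (\1_(\bigcup_n A n)).
Proof.
move=> BA; pose P n x : R := \prod_(i < n) (1 + -1 * \1_(A i) x).
have BP n : B (P n).
  elim: n => [|n IHn]; rewrite /P.
    by under eq_fun do rewrite big_ord0; exact: Bcst.
  under eq_fun do rewrite big_ord_recr/=.
  by apply: BM => //; apply: BD => //; exact: BZ.
have f01 i x : 0 <= 1 + -1 * (\1_(A i) x : R) <= 1.
  by rewrite indicE; case: (x \in _) => /=; lra.
apply: (Blim (u_ := fun n x => 1 + -1 * P n x) (C := 1)) => [n|n x|x].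
- by apply: BD => //; exact: BZ.
- have /andP[? ?] : 0 <= P n x <= 1.
    by apply/andP; split; [apply: prodr_ge0 => i _|apply: prodr_ile1 => i _];
      have /andP[] := f01 i x.
  by rewrite ger0_norm; lra.
have [[k _ Ak]|nA] := pselect ((\bigcup_n A n) x).
  rewrite indicE mem_set; last by exists k.
  apply: cvg_near_cst; exists k.+1 => // n /= kn.
  rewrite /P (bigD1 (Ordinal kn))//= indicE mem_set//=; lra.
rewrite indicE memNset//= (_ : (fun n => _) = cst 0); first exact: cvg_cst.
apply/funext => n; rewrite /P big1 => [|i _]; first by rewrite /=; lra.
by rewrite indicE memNset/=; [lra|move=> Ai; apply: nA; exists i].
Qed.

End bounded_algebra.

(** * The sigma-algebra of sets with approximable indicator *)

Section span_algebra.
Context {R : realType} {dd} {T : measurableType dd} {K : eqType}.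
Variables (mu : {measure set T -> \bar R}) (X : set T).
Variables (S : set K) (e : K -> T -> R[i]).
Hypotheses (mX : measurable X) (muX : (mu X < +oo)%E).
Hypotheses (me : forall k, S k -> cmeasurable X (e k)).
Hypotheses (span_1 : span S e (fun=> 1))
  (spanM : forall p q, span S e p -> span S e q -> span S e (fun x => p x * q x))
  (span_bounded : forall p, span S e p -> exists C, forall x, normc (p x) ^+ 2 <= C).
Local Notation Approx := (L2_closure mu X S e).

(** [L2_closureM] is applied twice: boundedness of f reduces g to an element p of the span, and
    boundedness of p reduces f to an element of the span. *)
Lemma L2_closure_mul f g (C : R) : cmeasurable X f -> cmeasurable X g ->
  (forall x, X x -> normc (f x) ^+ 2 <= C) -> Approx f -> Approx g ->
  Approx (fun x => f x * g x).
Proof.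
move=> mf mg fC af ag.
apply: (@L2_closureM _ _ _ _ mu X S e mX me g f C) => // p sp.
have [D pD] := span_bounded sp.
apply: (@eq_L2_closure _ _ _ _ mu X S e (fun x => p x * f x)).
  by move=> x _; rewrite mulrC.
apply: (@L2_closureM _ _ _ _ mu X S e mX me f p D) => //.
- exact: (cmeasurable_span me sp).
- by move=> q sq; apply: span_L2_closure; exact: spanM.
Qed.

(* These functions form an algebra closed under bounded pointwise limits, so
   the sets whose indicator belongs to it form a sigma-algebra. *)
Definition span_real (u : T -> R) := [/\ measurable_fun X u,
  exists C : R, forall x, `|u x| <= C & Approx (fun x => (u x)%:C%C)].

(** Equality is asked on X only, while the bound in [span_real] ranges over all of T; hence the
    separate bound on v. *)
Lemma eq_span_real u v (C : R) : (forall x, X x -> u x = v x) ->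
  (forall x, `|v x| <= C) -> span_real u -> span_real v.
Proof.
move=> uv vC [mu_ _ au]; split; [|by exists C|].
- by apply: (@eq_measurable_fun _ _ _ _ X u) => // x /set_mem /uv.
- by apply: eq_L2_closure au => x Xx; rewrite uv.
Qed.

Let span_cst (c : R[i]) : span S e (fun=> c).
Proof. by have := spanZ c span_1; under eq_fun do rewrite mulr1. Qed.

Lemma span_real_cst c : span_real (fun=> c).
Proof.
split; [exact: measurable_cst|by exists (`|c|)|].
by apply: span_L2_closure; exact: span_cst.
Qed.

Lemma span_realD u v : span_real u -> span_real v -> span_real (fun x => u x + v x).
Proof.
move=> [mu_ [C uC] au] [mv [D vD] av]; split; first exact: measurable_funD.
  by exists (C + D) => x; rewrite (le_trans (ler_normD _ _))// lerD.
have := L2_closureD mX me (cmeasurable_real mu_) (cmeasurable_real mv) au av.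
by apply: eq_L2_closure => x _; rewrite rmorphD.
Qed.

Lemma span_realM u v : span_real u -> span_real v -> span_real (fun x => u x * v x).
Proof.
move=> [mu_ [C uC] au] [mv [D vD] av]; split; first exact: measurable_funM.
  by exists (C * D) => x; rewrite normrM ler_pM.
have uC2 x : X x -> normc (u x)%:C%C ^+ 2 <= C ^+ 2.
  by move=> _; rewrite normc_real lerXn2r// nnegrE (le_trans _ (uC x)).
have := L2_closure_mul (cmeasurable_real mu_) (cmeasurable_real mv) uC2 au av.
by apply: eq_L2_closure => x _; rewrite rmorphM.
Qed.

Lemma span_real_bounded u : span_real u -> exists C : R, forall x, `|u x| <= C.
Proof. by case. Qed.

Lemma span_real_lim (u_ : (T -> R)^nat) u (C : R) : (forall n, span_real (u_ n)) ->
    (forall n x, `|u_ n x| <= C) -> (forall x, u_ n x @[n --> \oo] --> u x) -> span_real u.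
Proof.
move=> tu uC ucv.
have uC' x : `|u x| <= C.
  have cn : `|u_ n x| @[n --> \oo] --> `|u x| by exact: cvg_norm (ucv x).
  rewrite -(cvg_lim _ cn)//; apply: limr_le.
    by apply/cvg_ex; exists `|u x|.
  by apply: nearW => n; exact: uC.
have mu_ : measurable_fun X u.
  by apply: measurable_fun_cvg (fun x _ => ucv x) => n; case: (tu n).
split => //; first by exists C.
apply: (L2_closure_closed mX me); first exact: cmeasurable_real.
have mun n : measurable_fun X (u_ n) by case: (tu n).
have mD n : cmeasurable X (fun x => (u x - u_ n x)%:C%C).
  by apply: cmeasurable_real; exact: measurable_funB.
move=> eps eps0.
have [n un] : exists n, (Lsq mu X (fun x => (u x - u_ n x)%:C%C) < eps%:E)%E.
  (* Both u and u_n are bounded by C; the constant dominating function is integrable because X has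
     finite measure. *)
  apply: (@Lsq_dct _ _ _ mu X _ (fun=> (C + C) ^+ 2) mX mD) => //.
  - by rewrite integral_cst// lte_mul_pinfty// lee_fin sqr_ge0.
  - move=> n x _; rewrite normc_real lerXn2r ?nnegrE//.
      by rewrite addr_ge0// (le_trans _ (uC' x)).
    by rewrite (le_trans (ler_normB _ _))// lerD.
  - move=> x _; under eq_fun do rewrite normc_real.
    rewrite (_ : 0 = `|0 : R| ^+ 2 :> R); last by rewrite normr0 expr0n.
    under eq_fun do rewrite expr2; rewrite expr2.
    have cn : `|u x - u_ n x| @[n --> \oo] --> `|0 : R|.
      apply: cvg_norm; rewrite -(subrr (u x)); apply: cvgB => //; exact: cvg_cst.
    exact: cvgM.
exists (fun x => (u_ n x)%:C%C); split; [exact: cmeasurable_real|by case: (tu n)|].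
by under eq_fun do rewrite -rmorphB.
Qed.

Definition span_set (A : set T) := span_real (\1_A).

Lemma eq_span_set A A' : (forall x, X x -> A x <-> A' x) -> span_set A -> span_set A'.
Proof.
move=> AA'; apply: (@eq_span_real _ _ 1) => x.
  move=> Xx; rewrite !indicE; congr (nat_of_bool _)%:R.
  by apply/idP/idP => /set_mem/AA'/mem_set; apply.
by rewrite indicE; case: (_ \in _); rewrite ?normr1 ?normr0.
Qed.

Lemma span_setC A : span_set A -> span_set (~` A).
Proof. exact: (bounded_algebra_indicC span_real_cst span_realD span_realM). Qed.

Lemma span_setI A A' : span_set A -> span_set A' -> span_set (A `&` A').
Proof. exact: (bounded_algebra_indicI span_realM). Qed.

Lemma span_set_bigcup (A : (set T)^nat) : (forall n, span_set (A n)) ->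
  span_set (\bigcup_n A n).
Proof. exact: (bounded_algebra_bigcup span_real_cst span_realD span_realM span_real_lim). Qed.

Lemma span_set_gt0 u : span_real u -> span_set [set x | 0 < u x].
Proof.
exact: (bounded_algebra_gt0 span_real_cst span_realD span_realM span_real_bounded
  span_real_lim).
Qed.

Lemma span_setT : span_set setT.
Proof.
by apply: (eq_span_real (C := 1)) (span_real_cst 1) => x; rewrite indicT// normr1.
Qed.

Lemma span_setU A A' : span_set A -> span_set A' -> span_set (A `|` A').
Proof.
move=> /span_setC tA /span_setC tA'.
by rewrite -[_ `|` _]setCK setCU; apply: span_setC; exact: span_setI.
Qed.

End span_algebra.

(** * From indicators to all of L^2 *)

Section span_dense.
Context {R : realType} {dd} {T : measurableType dd} {K : eqType}.
Variables (mu : {measure set T -> \bar R}) (X : set T).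
Variables (S : set K) (e : K -> T -> R[i]).
Hypotheses (mX : measurable X) (muX : (mu X < +oo)%E).
Hypotheses (me : forall k, S k -> cmeasurable X (e k)).
Hypotheses (span_1 : span S e (fun=> 1))
  (spanM : forall p q, span S e p -> span S e q -> span S e (fun x => p x * q x))
  (span_bounded : forall p, span S e p -> exists C, forall x, normc (p x) ^+ 2 <= C).
Hypothesis (span_all : forall A, measurable A -> span_set mu X S e A).
Local Notation Approx := (L2_closure mu X S e).

Import HBNNSimple.

Let closure_nnsfun (h : {nnsfun T >-> R}) : Approx (fun x => (h x)%:C%C).
Proof.
have [n [c [A [mA hE]]]] : exists n (c : nat -> R) (A : nat -> set T),
    (forall i, measurable (A i)) /\
    forall x, (h x)%:C%C = \sum_(i < n) (c i)%:C%C * (\1_(A i) x)%:C%C.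
  pose r : seq R := finmap.enum_fset (fset_set (range h)).
  exists (size r), (nth 0 r), (fun i => h @^-1` [set nth 0 r i]); split => // x.
  rewrite (fimfunE h x) fsbig_finite//= (big_nth 0)/= big_mkord rmorph_sum/=.
  by apply: eq_bigr => i _; rewrite rmorphM.
under eq_fun do rewrite hE.
have mAc i : cmeasurable X (fun x => (\1_(A i) x)%:C%C : R[i]).
  by apply: cmeasurable_real; exact: measurable_indic.
suff : cmeasurable X (fun x => \sum_(i < n) (c i)%:C%C * (\1_(A i) x)%:C%C : R[i]) /\
    Approx (fun x => \sum_(i < n) (c i)%:C%C * (\1_(A i) x)%:C%C).
  by case.
elim: n {hE} => [|n [IHm IHa]].
  under eq_fun do rewrite big_ord0; split; first exact: cmeasurable_cst.
  by apply: span_L2_closure; exact: span0.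
under eq_fun do rewrite big_ord_recr/=.
have mn : cmeasurable X (fun x => (c n)%:C%C * (\1_(A n) x)%:C%C : R[i]).
  by apply: cmeasurableZ.
split; first exact: cmeasurableD.
apply: (L2_closureD mX me) => //.
by apply: (L2_closureZ mX me) => //; have [_ _] := span_all (mA n).
Qed.

Let closure_ge0 (g : T -> R) : measurable_fun X g -> (forall x, 0 <= g x) ->
  (\int[mu]_(x in X) (g x ^+ 2)%:E < +oo)%E -> Approx (fun x => (g x)%:C%C).
Proof.
move=> mg g0 goo.
have mG : measurable_fun X (EFin \o g) by exact/measurable_EFinP.
pose s n := nnsfun_approx mX mG n.
have G0 x : X x -> (0 <= (EFin \o g) x)%E by rewrite lee_fin.
have scv x : X x -> s n x @[n --> \oo] --> g x.
  by move=> Xx; have /fine_cvgP[_] := cvg_nnsfun_approx mX mG G0 Xx.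
have sg n x : X x -> 0 <= s n x <= g x.
  move=> Xx; apply/andP; split => //.
  by rewrite -lee_fin /s nnsfun_approxE; exact: le_approx.
have ms n : measurable_fun X (s n) by exact: measurable_funTS.
apply: (L2_closure_closed mX me); first exact: cmeasurable_real.
move=> eps eps0.
have mD n : cmeasurable X (fun x => (g x - s n x)%:C%C).
  by apply: cmeasurable_real; exact: measurable_funB.
have [n un] : exists n, (Lsq mu X (fun x => (g x - s n x)%:C%C) < eps%:E)%E.
  (* The simple functions increase to g, so 0 <= g - s_n <= g and g^2 dominates. *)
  apply: (@Lsq_dct _ _ _ mu X _ (fun x => g x ^+ 2) mX mD) => //.
  - exact: measurable_funX.
  - move=> n x Xx; rewrite normc_real; have /andP[s0 sgx] := sg n x Xx.
    by rewrite ger0_norm ?subr_ge0// lerXn2r ?nnegrE ?subr_ge0// lerBlDr lerDl.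
  - move=> x Xx; under eq_fun do rewrite normc_real.
    rewrite (_ : 0 = `|0 : R| ^+ 2 :> R); last by rewrite normr0 expr0n.
    under eq_fun do rewrite expr2; rewrite expr2.
    have cn : `|g x - s n x| @[n --> \oo] --> `|0 : R|.
      apply: cvg_norm; rewrite -(subrr (g x)); apply: cvgB; last exact: scv.
      exact: cvg_cst.
    exact: cvgM.
exists (fun x => (s n x)%:C%C); split; [exact: cmeasurable_real|exact: closure_nnsfun|].
by under eq_fun do rewrite -rmorphB.
Qed.

Let closure_real (g : T -> R) : measurable_fun X g ->
  (\int[mu]_(x in X) (g x ^+ 2)%:E < +oo)%E -> Approx (fun x => (g x)%:C%C).
Proof.
move=> mg goo.
have part (p : R -> R) : measurable_fun setT p -> (forall y, 0 <= p y) ->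
    (forall y, p y ^+ 2 <= y ^+ 2) ->
    cmeasurable X (fun x => (p (g x))%:C%C) /\ Approx (fun x => (p (g x))%:C%C).
  move=> mp p0 p2; have mpg : measurable_fun X (p \o g) by exact: measurableT_comp.
  split; first exact: cmeasurable_real.
  apply: closure_ge0 => //; apply: le_lt_trans goo; apply: ge0_le_integral => //.
  - by move=> x _; rewrite lee_fin sqr_ge0.
  - by apply/measurable_EFinP; exact: (measurable_funX 2 mpg).
  - by apply/measurable_EFinP; exact: measurable_funX.
  - by move=> x _; rewrite lee_fin p2.
have [|y|y|m1 a1] := part (fun y => Num.max y 0).
- exact: measurable_maxr.
- by rewrite le_max lexx orbT.
- by case: (leP y 0) => y0; rewrite ?expr0n//= sqr_ge0.
have [|y|y|m2 a2] := part (fun y => Num.max (- y) 0).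
- by apply: measurable_maxr => //; exact: measurable_funN.
- by rewrite le_max lexx orbT.
- by case: (leP (- y) 0) => y0; rewrite ?expr0n/= ?sqr_ge0// sqrrN.
have mN2 := cmeasurableZ (-1) m2.
have := L2_closureD mX me m1 mN2 a1 (L2_closureZ mX me (-1) m2 a2).
apply: eq_L2_closure => x _; rewrite mulN1r -rmorphB/=; congr (_%:C)%C.
by case: (leP (g x) 0) => gx; case: (leP (- g x) 0) => gx'; lra.
Qed.

Theorem L2_closure_all (f : T -> R[i]) : cmeasurable X f ->
  (Lsq mu X f < +oo)%E -> Approx f.
Proof.
move=> mf foo; have [mr mi] := mf.
have part (p : R[i] -> R) : measurable_fun X (p \o f) ->
    (forall z, p z ^+ 2 <= normc z ^+ 2) -> Approx (fun x => (p (f x))%:C%C).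
  move=> mp p2; apply: closure_real => //.
  apply: le_lt_trans foo; apply: ge0_le_integral => //.
  - by move=> x _; rewrite lee_fin sqr_ge0.
  - by apply/measurable_EFinP; exact: (measurable_funX 2 mp).
  - exact: measurable_sqr_normc.
  - by move=> x _; rewrite lee_fin p2.
have ar := part (@complex.Re R) mr _; have ai := part (@complex.Im R) mi _.
have mir := cmeasurable_real mr; have mii := cmeasurable_real mi.
have := L2_closureD mX me mir (cmeasurableZ 'i%C mii) (ar _)
   (L2_closureZ mX me 'i%C mii (ai _)).
move=> /(_ _ _)/wrap[z|z|].
- by rewrite sqr_normcE lerDl sqr_ge0.
- by rewrite sqr_normcE lerDr sqr_ge0.
by apply: eq_L2_closure => x _; rewrite -complexE.
Qed.

End span_dense.

(** * Trigonometric polynomials on the fundamental domain *)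

Section trig_dense.
Context {R : realType} {d : nat} (M : 'M[R]_d).
Hypothesis Munit : M \in unitmx.
Local Notation L := (lebesgue_space R d).
Local Notation mu := (lebesgue R d).
Local Notation I := (fundamental_domain M).
Local Notation e_ := (fun h : 'cV[R]_d => expo h : L -> R[i]).
Local Notation tspan := (span (dual_lattice M) e_).
Local Notation tset := (@span_set R _ L _ mu (I : set L) (dual_lattice M) e_).
Local Notation treal := (@span_real R _ L _ mu (I : set L) (dual_lattice M) e_).

Let mI : measurable (I : set L).
Proof. exact: lebesgue_measurable_fundamental_domain. Qed.

Let muI : (mu I < +oo)%E.
Proof. exact: lebesgue_fundamental_domain_fin. Qed.

Let me_ (h : 'cV[R]_d) : dual_lattice M h -> cmeasurable (I : set L) (e_ h).
Proof. by move=> _; exact: (cmeasurableS measurableT (@subsetT _ _) (cmeasurable_expo h)). Qed.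

Let tspan1 : tspan (fun=> 1).
Proof.
have := @span1 R L _ (dual_lattice M) e_ 0 (@dual_lattice0 R d M).
by rewrite (_ : e_ 0 = (fun=> 1))//; apply/funext => x; rewrite expo0.
Qed.

Let tspanM p q : tspan p -> tspan q -> tspan (fun x => p x * q x).
Proof.
move=> [s sS ->] [t tS ->].
exists [seq (a.1 * b.1, a.2 + b.2) | a <- s, b <- t].
  by move=> _ /allpairsP[[a b] [/sS ha /tS hb ->]] /=; exact: dual_latticeD.
apply/funext => x; rewrite big_allpairs_dep mulr_suml; apply: eq_bigr => a _.
by rewrite mulr_sumr; apply: eq_bigr => b _ /=; rewrite expoDl mulrACA.
Qed.

Let tspan_bounded p : tspan p -> exists C : R, forall x, normc (p x) ^+ 2 <= C.
Proof.
move=> [s _ ->]; exists ((\sum_(a <- s) normc a.1) ^+ 2) => x.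
have le1 : normc (\sum_(a <- s) a.1 * expo a.2 x) <= \sum_(a <- s) normc a.1.
  apply: (le_trans (normc_sum _ _ _)); apply: ler_sum => a _.
  by rewrite Normc.normcM normc_expo mulr1.
by rewrite lerXn2r ?nnegrE ?normc_ge0// (le_trans _ le1)// normc_ge0.
Qed.

(** The rows of the inverse of M are the dual basis: pairing with them reads off lattice
    coordinates. *)
Let row_dual (i : 'I_d) : 'cV[R]_d := (row i (invmx M))^T.

Let dot_row_dual i x : dot (row_dual i) x = lattice_coord M i x.
Proof. by rewrite /dot /lattice_coord mxE; apply: eq_bigr => j _; rewrite !mxE. Qed.

Let row_dual_dual i : dual_lattice M (row_dual i).
Proof.
move=> _ [z _ <-]; rewrite dot_row_dual /lattice_coord mulKmx// mxE.
exact: intr_int.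
Qed.

(** For p the real or the imaginary part, Euler's formulas express p (e_h) through e_h and
    e_(-h). *)
Let treal_expo (p : R[i] -> R) (c1 c2 : R[i]) h :
  (forall x : L, (p (expo h x))%:C%C = c1 * expo h x + c2 * expo (- h) x) ->
  (forall z, `|p z| <= normc z) ->
  measurable_fun setT (fun x : L => p (expo h x)) ->
  dual_lattice M h -> treal (fun x : L => p (expo h x)).
Proof.
move=> pE p1 mp hH; split.
- exact: (measurable_funS measurableT (@subsetT _ _) mp).
- by exists 1 => x; rewrite (le_trans (p1 _))// normc_expo.
apply: span_L2_closure; rewrite (_ : (fun x : L => _) =
  (fun x : L => c1 * e_ h x + c2 * e_ (- h) x)); last by apply/funext => x; rewrite pE.
by apply: spanD; apply: spanZ; apply: span1 => //; exact: dual_latticeN.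
Qed.

Let cos_real i : treal (fun x : L => cos (2 * pi * lattice_coord M i x)).
Proof.
have := @treal_expo (@complex.Re R) 2^-1 2^-1 (row_dual i) _ _ _ (row_dual_dual i).
have -> : (fun x : L => complex.Re (expo (row_dual i) x)) =
   (fun x : L => cos (2 * pi * lattice_coord M i x)).
  by apply/funext => x; rewrite /= dot_row_dual.
apply.
- by move=> x; rewrite -mulrDr -conj_expo addcJ mulrA mulVf ?mul1r//.
- move=> z; rewrite -ler_sqr ?nnegrE ?normc_ge0// real_normK ?num_real//.
  by rewrite sqr_normcE lerDl sqr_ge0.
have [+ _] := cmeasurable_expo (row_dual i).
by under eq_fun do rewrite /= dot_row_dual.
Qed.

Let sin_real i : treal (fun x : L => sin (2 * pi * lattice_coord M i x)).
Proof.
have := @treal_expo (@complex.Im R) (2 * 'i%C)^-1 (- (2 * 'i%C)^-1) (row_dual i)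
  _ _ _ (row_dual_dual i).
have -> : (fun x : L => complex.Im (expo (row_dual i) x)) =
   (fun x : L => sin (2 * pi * lattice_coord M i x)).
  by apply/funext => x; rewrite /= dot_row_dual.
have i0 : (2 * 'i%C : R[i]) != 0 by rewrite mulf_neq0 ?pnatr_eq0// eq_complex/= oner_eq0 andbF.
apply.
- by move=> x; rewrite mulNr -mulrBr -conj_expo subcJ mulrAC mulrA mulVf ?mul1r//.
- move=> z; rewrite -ler_sqr ?nnegrE ?normc_ge0// real_normK ?num_real//.
  by rewrite sqr_normcE lerDr sqr_ge0.
have [_] := cmeasurable_expo (row_dual i).
by under eq_fun do rewrite /= dot_row_dual.
Qed.

Let tset_eq (A A' : set L) : (forall x : L, I x -> A x <-> A' x) -> tset A -> tset A'.
Proof. exact: (@eq_span_set R _ L _ mu (I : set L) (dual_lattice M) e_ A A'). Qed.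

Let tsetT : tset setT.
Proof. exact: (span_setT mu (I : set L) tspan1). Qed.

Let tsetC (A : set L) : tset A -> tset (~` A).
Proof. exact: (span_setC mI me_ tspan1 tspanM tspan_bounded). Qed.

Let tset0 : tset set0.
Proof. by rewrite -setCT; exact: tsetC. Qed.

Let tsetI (A A' : set L) : tset A -> tset A' -> tset (A `&` A').
Proof. exact: (span_setI mI me_ tspanM tspan_bounded). Qed.

Let tsetU (A A' : set L) : tset A -> tset A' -> tset (A `|` A').
Proof. exact: (span_setU mI me_ tspan1 tspanM tspan_bounded). Qed.

Let tset_bigcup (A : (set L)^nat) : (forall n, tset (A n)) -> tset (\bigcup_n A n).
Proof. exact: (span_set_bigcup mI muI me_ tspan1 tspanM tspan_bounded). Qed.

Let tset_affine (u : L -> R) (a b : R) : treal u -> tset [set x | 0 < a + b * u x].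
Proof.
move=> tu; apply: (span_set_gt0 mI muI me_ tspan1 tspanM tspan_bounded).
apply: (span_realD mI me_ (span_real_cst mu (I : set L) tspan1 a)).
exact: (span_realM mI me_ tspanM tspan_bounded (span_real_cst mu (I : set L) tspan1 b)).
Qed.

Let sin_2pi_lt0 (y : R) : - 2^-1 < y -> y < 0 -> sin (2 * pi * y) < 0.
Proof.
move=> y1 y0; have pi0 := @pi_gt0 R.
rewrite -[X in sin X]opprK sinN oppr_lt0; apply: sin_gt0_pi; apply/andP; split; nra.
Qed.

Let sin_2pi_ge0 (y : R) : 0 <= y -> y < 2^-1 -> 0 <= sin (2 * pi * y).
Proof.
by move=> y0 y1; have pi0 := @pi_gt0 R; apply: sin_ge0_pi; apply/andP; split; nra.
Qed.

Let ltr_cos_2pi (a b : R) : 0 <= a <= 2^-1 -> 0 <= b <= 2^-1 ->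
  (cos (2 * pi * a) < cos (2 * pi * b)) = (b < a).
Proof.
move=> /andP[a0 a1] /andP[b0 b1]; have pi0 := @pi_gt0 R.
rewrite ltr_cos ?in_itv/=; first by rewrite ltr_pM2l// mulr_gt0.
- by apply/andP; split; nra.
- by apply/andP; split; nra.
Qed.

Let cos_2piN (y : R) : cos (2 * pi * - y) = cos (2 * pi * y).
Proof. by rewrite mulrN cosN. Qed.

(** On [-1/2, 1/2) the sine of 2 pi y is negative exactly for -1/2 < y < 0. The end point -1/2,
    where the sine vanishes, is caught as the only zero of 1 + cos. *)
Let tset_neg i : tset [set x | lattice_coord M i x < 0].
Proof.
apply: tset_eq (tsetU (tset_affine 0 (-1) (sin_real i)) (tsetC (tset_affine 1 1 (cos_real i)))).
move=> x; rewrite (fundamental_domainE Munit) => /(_ i); set y := lattice_coord M i x.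
have cospi1 : cos (2 * pi * 2^-1) = -1 :> R by rewrite mulrAC divff// mul1r cospi.
move=> /andP[y1 y2]; rewrite /setU /setC/= add0r mulN1r oppr_gt0 mul1r -/y; split; last first.
  move=> y0; have [ym|ym] := leP y (- 2^-1); [right|left; exact: sin_2pi_lt0].
  have -> : y = - 2^-1 by apply/eqP; rewrite eq_le ym.
  by rewrite cos_2piN cospi1 subrr ltxx.
move=> [|/negP]; apply: contraPT; rewrite -leNgt => y0.
  by apply/negP; rewrite -leNgt; exact: sin_2pi_ge0.
apply/negP; rewrite negbK -ltrBlDl sub0r -cospi1 ltr_cos_2pi//; first
  by rewrite invr_ge0 ler0n lexx.
by rewrite y0 ltW.
Qed.

(** The cosine alone sees only |y|, on which it is strictly monotone over [0, 1/2]; combined with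
    the sign of y it cuts out every half-line inside (-1/2, 1/2). *)
Let tset_lt i (c : R) : tset [set x | lattice_coord M i x < c].
Proof.
have h0 : 0 < 2^-1 :> R by rewrite invr_gt0.
have [c1|c1] := leP c (- 2^-1).
  apply: tset_eq tset0 => x; rewrite (fundamental_domainE Munit) => /(_ i)/andP[y1 _].
  by split=> //= yc; have := lt_le_trans yc c1; rewrite ltNge y1.
have [c2|c2] := leP 2^-1 c.
  apply: tset_eq tsetT => x; rewrite (fundamental_domainE Munit) => /(_ i)/andP[_ y2].
  by split=> //= _; exact: lt_le_trans c2.
have [c0|c0] := leP c 0.
  apply: tset_eq (tsetI (tset_neg i) (tset_affine (cos (2 * pi * c)) (-1) (cos_real i))).
  move=> x; rewrite (fundamental_domainE Munit) => /(_ i)/andP[y1 y2].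
  rewrite /setI/= mulN1r subr_gt0 -(cos_2piN c) -(cos_2piN (lattice_coord M i x)); split.
    move=> [yn]; rewrite ltr_cos_2pi ?ltrN2//; apply/andP; split; lra.
  by move=> yc; split; [lra|rewrite ltr_cos_2pi ?ltrN2//; apply/andP; split; lra].
apply: tset_eq (tsetU (tset_neg i) (tset_affine (- cos (2 * pi * c)) 1 (cos_real i))).
move=> x; rewrite (fundamental_domainE Munit) => /(_ i)/andP[y1 y2].
rewrite /setU/= mul1r addrC subr_gt0; split.
  have [y0 _|y0] := ltP (lattice_coord M i x) 0; first exact: lt_trans c0.
  by case=> //; rewrite ltr_cos_2pi//; apply/andP; split; lra.
move=> yc; have [y0|y0] := ltP (lattice_coord M i x) 0; [by left|right].
by rewrite ltr_cos_2pi//; apply/andP; split; lra.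
Qed.

Let tset_sigma_algebra : sigma_algebra setT (tset : set_system 'cV[R]_d).
Proof.
split; [exact: tset0| |exact: tset_bigcup].
by move=> A tA; rewrite setTD; exact: tsetC.
Qed.

Local Notation T' := (g_sigma_algebraType (tset : set_system 'cV[R]_d)).

Let measurable_tset (A : set T') : measurable A -> tset A.
Proof. by apply: smallest_sub => //; exact: tset_sigma_algebra. Qed.

Let measurable_coord' i :
  measurable_fun (setT : set T') (lattice_coord M i : T' -> R).
Proof.
apply: (@measurability _ _ _ _ _ _ (@RGenInftyO.G R)).
  exact: RGenInftyO.measurableE.
move=> _ [_ [c ->] <-]; rewrite setTI.
apply: sub_gen_smallest; apply: tset_eq (tset_lt i c) => x _ /=.
by rewrite in_itv.
Qed.

(** With the approximable sets as sigma-algebra on the source, measurability of the identity says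
    that every Borel set is approximable; it need only be checked on coordinates. *)
Let measurable_id' : measurable_fun (setT : set T') (id : T' -> 'cV[R]_d).
Proof.
apply: measurable_fun_cV => i.
rewrite (_ : _ \o _ = (fun x : T' => \sum_(j < d) M i j * lattice_coord M j x : R)).
  by apply: measurable_sum => j; apply: measurable_funM => //; exact: measurable_coord'.
by apply/funext => x /=; rewrite /cV_coord (lattice_coordE Munit).
Qed.

Let tset_borel (A : set 'cV[R]_d) : measurable A -> tset A.
Proof.
move=> mA; apply: measurable_tset; rewrite -[A]preimage_id -[X in measurable X]setTI.
exact: measurable_id'.
Qed.

(** Intersecting with I makes the measure finite, so a Borel hull B exists; the indicators of A and
    B then differ on I only on a null set. *)
Let tset_all (A : set L) : measurable A -> tset A.
Proof.
move=> mA; have mAI : measurable (A `&` (I : set L)) by exact: measurableI.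
have [|B [mB AB B0]] := lebesgue_borel_hull mAI.
  by apply: le_lt_trans muI; apply: le_measure; rewrite ?inE//; exact: subIsetr.
have mB' : measurable (B : set L) by exact: borel_lebesgue_measurable.
have [mBI [C BC] aB] := tset_borel mB.
split; first exact: measurable_indic.
  by exists 1 => x; rewrite indicE; case: (_ \in _); rewrite ?normr1 ?normr0.
apply: (L2_closure_closed mI me_); first by apply: cmeasurable_real; exact: measurable_indic.
pose N : set L := B `\` (A `&` I).
have mN : measurable N by exact: measurableD.
move=> eps eps0; exists (fun x : L => (\1_B x)%:C%C); split.
- by apply: cmeasurable_real; exact: measurable_indic.
- exact: aB.
rewrite (_ : Lsq mu _ _ = 0%E) ?lte_fin//.
have -> : Lsq mu (I : set L) (fun x => (\1_A x)%:C%C - (\1_B x)%:C%C)%R =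
    (\int[mu]_(x in (I : set L)) (\1_N x)%:E)%E.
  apply: eq_integral => x /set_mem Ix; congr (_%:E).
  rewrite -rmorphB normc_real real_normK ?num_real// /N !indicE.
  have [Ax|nAx] := pselect (A x).
    have Bx : B x by exact: AB.
    by rewrite (mem_set Ax) (mem_set Bx) memNset ?subrr ?expr0n// => -[_]; apply.
  rewrite (memNset nAx) sub0r sqrrN.
  have [Bx|nBx] := pselect (B x); last by rewrite !memNset ?expr0n// => -[].
  by rewrite !mem_set ?expr1n//; split=> // -[].
rewrite integral_indic//; apply/eqP; rewrite -measure_le0 -B0.
by apply: le_measure; rewrite ?inE//; exact: measurableI.
Qed.

Theorem trig_dense (f : L -> R[i]) : cmeasurable (I : set L) f ->
  (Lsq mu (I : set L) f < +oo)%E -> L2_closure mu (I : set L) (dual_lattice M) e_ f.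
Proof.
move=> mf foo.
exact: (L2_closure_all mI me_ tset_all mf foo).
Qed.

End trig_dense.

(** * Riesz bounds *)

Section riesz_of_finite.
Context {R : realType} {dd} {T : measurableType dd} {K : choiceType}.
Variables (mu : {measure set T -> \bar R}) (X : set T).
Variables (S : set K) (u : K -> T -> R[i]) (A B : R).
Hypotheses (mX : measurable X) (A0 : 0 < A) (B0 : 0 < B).
Hypothesis mu_ : forall k, S k -> cmeasurable X (u k).

Let N (c : K -> R[i]) (F : {fset K}) := \sum_(p <- F) normc (c p) ^+ 2.
Let f_ (c : K -> R[i]) (F : {fset K}) x := \sum_(p <- F) c p * u p x.

Hypothesis bounds : forall c (F : {fset K}), [set` F] `<=` S ->
  ((A * N c F)%:E <= Lsq mu X (f_ c F) <= (B * N c F)%:E)%E.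

Let big_fsetDK (V : nmodType) (g : K -> V) (F G : {fset K}) : (G `<=` F)%fset ->
  \sum_(p <- F) g p = \sum_(p <- G) g p + \sum_(p <- (F `\` G)%fset) g p.
Proof.
move=> GF; rewrite (big_fsetID _ (mem G)); congr (_ + _); apply: eq_fbigl => p.
  by rewrite !inE/=; have [/(fsubsetP GF) ->|]//= := boolP (p \in G); rewrite andbF.
by rewrite !inE/= andbC.
Qed.

Let cmf c (F : {fset K}) : [set` F] `<=` S -> cmeasurable X (f_ c F).
Proof.
move=> FS; rewrite /f_ /=.
have := @cmeasurable_sum R dd T X K F (fun p x => c p * u p x).
apply => p pF.
by apply: cmeasurableZ; apply: mu_; exact: FS.
Qed.

Section coefficients.
Variables (c : K -> R[i]) (E : R).
Hypothesis cE : \esum_(s in S) (normc (c s) ^+ 2)%:E = E%:E.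

Let N_le F : [set` F] `<=` S -> N c F <= E.
Proof.
move=> FS; rewrite -lee_fin -cE; apply: esum_ge; exists [set` F].
  by split => //; exact: finite_fset.
by rewrite fsbig_finite//= set_fsetK sumEFin.
Qed.

Let approx e : 0 < e -> exists2 F : {fset K}, [set` F] `<=` S & E - e < N c F.
Proof.
move=> e0; have := @ub_ereal_sup_adherent R
  [set \sum_(x \in F) (normc (c x) ^+ 2)%:E | F in fsets S]%E e e0.
rewrite -/(esum _ _) cE => /(_ isT)[_ [F [finF FS] <-]].
rewrite fsbig_finite//= sumEFin -EFinB lte_fin => EF.
by exists (fset_set F) => //; rewrite fset_setK.
Qed.

Let f_sub (F G : {fset K}) : (G `<=` F)%fset ->
  (fun x => f_ c F x - f_ c G x) = f_ c (F `\` G)%fset.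
Proof. by move=> GF; apply/funext => x; rewrite /f_ (big_fsetDK _ GF) addrC addKr. Qed.

Let tail (F G : {fset K}) e : (G `<=` F)%fset -> [set` F] `<=` S -> E - e <= N c G ->
  (Lsq mu X (fun x => f_ c F x - f_ c G x)%R <= (B * e)%:E)%E.
Proof.
move=> GF FS eG; rewrite f_sub//; have FGS : [set` (F `\` G)%fset] `<=` S.
  by move=> p /=; rewrite inE => /andP[_]; exact: FS.
have /andP[_ /le_trans] := bounds c FGS; apply; rewrite lee_fin ler_pM2l//.
have := N_le FS; rewrite /N (big_fsetDK _ GF) -/(N c G) => ?.
lra.
Qed.

(** If the coefficients outside a finite set have mass at most [eps n], the upper bound B leaves a
    remainder of squared norm 8^-n, the rate of [Lsq_complete]. *)
Let eps n := 8^-1 ^+ n / B.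

Let eps_gt0 n : 0 < eps n.
Proof. by rewrite divr_gt0// exprn_gt0. Qed.

Let exhaustion : exists G : nat -> {fset K},
  [/\ forall n, [set` G n] `<=` S, forall n m, (n <= m)%N -> (G n `<=` G m)%fset &
      forall n, E - eps n <= N c (G n)].
Proof.
have /choice[F FE] : forall n, exists F : {fset K}, [set` F] `<=` S /\ E - eps n < N c F.
  by move=> n; have [F FS EF] := approx (eps_gt0 n); exists F.
(* Unions make the sets increasing; n.+1 includes F n itself. *)
pose G n := \big[fsetU/fset0]_(i < n.+1) F i.
have GS n : [set` G n] `<=` S.
  move=> p /= /bigfcupP[i _ pF]; exact: (FE i).1.
exists G; split => //.
  by move=> n m nm; apply/fsubsetP => p /bigfcupP[i _ pF];
     apply/bigfcupP; exists (widen_ord (nm : n.+1 <= m.+1)%N i) => //; rewrite mem_index_enum.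
move=> n; apply: ltW; apply: (lt_le_trans (FE n).2).
have FG : (F n `<=` G n)%fset by rewrite /G big_ord_recr/= fsubsetUr.
rewrite {2}/N (big_fsetDK _ FG) lerDl; apply: sumr_ge0 => p _; exact: sqr_ge0.
Qed.

(** The sum g is the limit along one exhausting sequence of finite sets; the tail estimate extends
    the convergence to all finite sets that contain a late member of it. *)
Lemma riesz_sum : exists g, [/\ cmeasurable X g, (Lsq mu X g < +oo)%E,
  forall e, 0 < e -> exists2 F0, fsets S F0 & forall F, fsets S F -> F0 `<=` F ->
    (Lsq mu X (fun x => \sum_(s \in F) c s * u s x - g x)%R < (e ^+ 2)%:E)%E,
  ((A / 2 * E)%:E <= Lsq mu X g)%E & (Lsq mu X g <= (2 * B * E)%:E)%E].
Proof.
have [G [GS Gnd GE]] := exhaustion.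
have mfG n : cmeasurable X (f_ c (G n)) by exact: cmf.
have Beps n : B * eps n = 8^-1 ^+ n by rewrite /eps mulrC divfK// gt_eqF.
have [|g mg gG] := @Lsq_complete _ _ _ mu X (fun n => f_ c (G n)) mX mfG.
  by move=> n m nm; rewrite -Beps; apply: tail; [exact: Gnd|exact: GS|exact: GE].
have cv8 : (8^-1 ^+ n : R) @[n --> \oo] --> (0 : R).
  by apply: cvg_expr; rewrite ger0_norm ?invf_lt1// ltr1n.
have small (e : R) : 0 < e -> exists n, 8^-1 ^+ n < e.
  move=> e0; have /cvgrPdist_lt/(_ _ e0)[n _ /(_ n (leqnn n))] := cv8.
  by rewrite sub0r normrN ger0_norm ?exprn_ge0//; exists n.
exists g.
have ub n : (Lsq mu X g <= (2 * 8^-1 ^+ n + 2 * B * E)%:E)%E.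
  have -> : g = (fun x => (g x - f_ c (G n) x) + f_ c (G n) x).
    by apply/funext => x; rewrite subrK.
  apply: (le_trans (LsqD mu mX (cmeasurableB mg (mfG n)) (mfG n))).
  rewrite (EFinD (2 * _)); apply: leeD; first by rewrite EFinM lee_pmul2l// lte_fin.
  rewrite -mulrA EFinM lee_pmul2l//; have /andP[_] := bounds c (GS n).
  by move=> /le_trans; apply; rewrite lee_fin ler_pM2l//; exact: N_le.
have foo : (Lsq mu X g < +oo)%E by apply: (le_lt_trans (ub 0%N)); rewrite ltry.
split => //.
(* The tail and the distance from g to the partial sum over G n each contribute 2 * 8^-n. *)
- move=> e e0; have [|n ne] := small (e ^+ 2 / 4); first by rewrite divr_gt0 ?exprn_gt0.
  exists [set` G n]; first by split; [exact: finite_fset|exact: GS].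
  move=> F [finF FS] GF; rewrite -[F]fset_setK// in FS GF *.
  under eq_fun do rewrite fsbig_finite//= set_fsetK.
  have GF' : (G n `<=` fset_set F)%fset by apply/fsubsetP => p; exact: GF.
  rewrite -/(f_ c _).
  have -> : (fun x => f_ c (fset_set F) x - g x) = (fun x =>
      (f_ c (fset_set F) x - f_ c (G n) x) + - (g x - f_ c (G n) x)).
    by apply/funext => x; ring.
  have mD := cmeasurableB (cmf c FS) (mfG n).
  have mD' := cmeasurableN (cmeasurableB mg (mfG n)).
  apply: (le_lt_trans (LsqD mu mX mD mD')).
  have t1 := tail GF' FS (GE n); rewrite Beps in t1.
  have t2 := gG n; rewrite -LsqN in t2.
  apply: (@le_lt_trans _ _ (2%:E * (8^-1 ^+ n)%:E + 2%:E * (8^-1 ^+ n)%:E)%E).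
    by apply: leeD; rewrite lee_pmul2l.
  by rewrite -!EFinM -EFinD lte_fin; lra.
- have [r rE] : exists r, Lsq mu X g = r%:E.
    by exists (fine (Lsq mu X g)); rewrite fineK// ge0_fin_numE// Lsq_ge0.
  rewrite rE lee_fin -[leRHS]addr0; apply/ler_addgt0Pr => e e0.
  (* From A (E - eps n) <= 2 r + 2 * 8^-n follows A E / 2 <= r + 8^-n (1 + A / (2 B)); this choice
     makes the excess less than e. *)
  have [|n ne] := small (e / (1 + A / (2 * B))).
    by rewrite divr_gt0// addr_gt0// divr_gt0// mulr_gt0.
  have : ((A * N c (G n))%:E <= (2 * r + 2 * 8^-1 ^+ n)%:E)%E.
    have /andP[/le_trans + _] := bounds c (GS n); apply.
    have -> : f_ c (G n) = (fun x => g x + - (g x - f_ c (G n) x)).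
      by apply/funext => x; ring.
    apply: (le_trans (LsqD mu mX mg (cmeasurableN (cmeasurableB mg (mfG n))))).
    rewrite rE (EFinD (2 * _)) -!EFinM; apply: leeD => //.
    by rewrite EFinM lee_pmul2l// LsqN.
  rewrite lee_fin => AN; have := GE n; rewrite -(ler_pM2l A0) mulrBr => AE.
  rewrite ltr_pdivlMr in ne; last by rewrite addr_gt0// divr_gt0// mulr_gt0.
  have : 8^-1 ^+ n * (1 + A / (2 * B)) = 8^-1 ^+ n + A * eps n / 2.
    by rewrite /eps; field; rewrite gt_eqF.
  move=> eq8; rewrite eq8 in ne; lra.
- apply/lee_addgt0Pr => e e0; have [|n ne] := small (e / 2); first by rewrite divr_gt0.
  apply: (le_trans (ub n)); rewrite -EFinD lee_fin addrC lerD2l; lra.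
Qed.

End coefficients.

End riesz_of_finite.

(** * The exponentials of frequencies a_j + h on Omega *)

Section structured.
Context {R : realType} {d k : nat} (M : 'M[R]_d) (Omega J : set 'cV[R]_d).
Variables (alpha : 'cV[R]_d) (delta : R).
Local Notation L := (lebesgue_space R d).
Local Notation mu := (lebesgue R d).
Local Notation I := (fundamental_domain M).
Hypotheses (Munit : M \in unitmx) (mX : measurable (Omega : set L)).
Hypotheses (mJ : measurable (J : set L)) (JI : J `<=` I) (J0 : mu (I `\` J) = 0%E).
Hypothesis delta_gt0 : 0 < delta.
Hypothesis enum : forall w, J w -> exists g : 'I_k -> 'cV[R]_d,
  [/\ injective g, range g = lattice_fiber M Omega w &
   forall i j, i != j -> delta <= normc (expo alpha (g i) - expo alpha (g j))].

Let mI : measurable (I : set L).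
Proof. exact: lebesgue_measurable_fundamental_domain. Qed.

Lemma esum_range (g : 'I_k -> 'cV[R]_d) (phi : 'cV[R]_d -> \bar R) :
  injective g -> (forall l, (0 <= phi l)%E) ->
  (\esum_(l in range g) phi l = \sum_(i < k) phi (g i))%E.
Proof.
move=> ginj phi0; rewrite esum_image ?esum_fset//; last by move=> i j _ _; exact: ginj.
rewrite [RHS]fsbig_seq ?index_enum_uniq//.
rewrite (_ : [set` _] = setT)//; last first.
  by apply/seteqP; split=> // i _; exact: mem_index_enum.
exact: finite_finset.
Qed.

Lemma Lsq_fold (f : L -> R[i]) : cmeasurable (Omega : set L) f ->
  (Lsq mu (Omega : set L) f = \int[mu]_(w in (J : set L))
     \esum_(l in lattice_fiber M Omega w) (normc (f (l + w)%R) ^+ 2)%:E)%E.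
Proof.
move=> mf; have mF := measurable_sqr_normc mf.
have F0 (x : L) : (0 <= (normc (f x) ^+ 2)%:E)%E by rewrite lee_fin sqr_ge0.
rewrite [LHS](integral_fold Munit mX mF F0).
have mIJ : measurable ((I : set L) `\` (J : set L)) by exact: measurableD.
have := @ge0_negligible_integral _ L R mu I (I `\` J) _ mIJ mI _ _ J0.
rewrite setDD (setIidr JI); apply.
- exact: (measurable_funS measurableT (@subsetT _ _) (measurable_fold Munit mX mF F0)).
- by move=> w _; apply: esum_ge0 => l _; exact: F0.
Qed.

Let a (j : 'I_k) := alpha *+ j.

(** The coefficients F are frozen at w while l runs over the fiber: this encodes Lambda-periodic F_j
    through their values at w alone. *)
Let structured_eq (f : L -> R[i]) (F : 'I_k -> R[i]) (w : L) := forall l,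
  lattice_fiber M Omega w l -> f (l + w) = \sum_(j < k) expo (a j) (l + w) * F j.

Lemma structured_bounds : exists A B : R, [/\ 0 < A, 0 < B &
  forall (f : L -> R[i]) (F : 'I_k -> L -> R[i]), cmeasurable (Omega : set L) f ->
  (forall j, cmeasurable (J : set L) (F j)) ->
  (forall w, J w -> structured_eq f (F ^~ w) w) ->
  (A%:E * \sum_(j < k) Lsq mu (J : set L) (F j) <= Lsq mu (Omega : set L) f <=
   B%:E * \sum_(j < k) Lsq mu (J : set L) (F j))%E].
Proof.
have [A [B [A0 B0 AB]]] := vandermonde_bounds k delta_gt0.
exists A, B; split=> // f F mf mF fF; rewrite Lsq_fold//.
have mF2 j := measurable_sqr_normc (mF j).
have F20 j (w : L) : (0 <= (normc (F j w) ^+ 2)%:E)%E by rewrite lee_fin sqr_ge0.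
have sumE (c : R) : 0 < c -> (c%:E * \sum_(j < k) Lsq mu (J : set L) (F j) =
    \int[mu]_(w in (J : set L)) (c * \sum_(j < k) normc (F j w) ^+ 2)%:E)%E.
  move=> c0; rewrite -ge0_integral_sum; [|exact: mJ|exact: mF2|by move=> j w _; exact: F20].
  rewrite -ge0_integralZl; [| exact: mJ | by apply: emeasurable_sum => j; exact: mF2
    | by move=> w _; apply: sume_ge0 => j _; exact: F20 | exact: ltW].
  by apply: eq_integral => w _; rewrite sumEFin.
have point (w : L) : J w ->
    ((A * \sum_(j < k) normc (F j w) ^+ 2)%:E <=
     \esum_(l in lattice_fiber M Omega w) (normc (f (l + w)%R) ^+ 2)%:E <=
     (B * \sum_(j < k) normc (F j w) ^+ 2)%:E)%E.
  move=> Jw; have [g [ginj gE gd]] := enum Jw.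
  rewrite -gE esum_range//; last by move=> l; rewrite lee_fin sqr_ge0.
  have z1 i : normc (expo alpha (g i)) = 1 by exact: normc_expo.
  have := AB (fun i => expo alpha (g i)) z1 gd (fun j => expo (a j) w * F j w).
  have -> : \sum_(j < k) normc (expo (a j) w * F j w) ^+ 2 =
      \sum_(j < k) normc (F j w) ^+ 2.
    by apply: eq_bigr => j _; rewrite Normc.normcM normc_expo mul1r.
  rewrite (_ : \sum_(i < k) normc (\sum_(j < k) _) ^+ 2 =
      \sum_(i < k) normc (f (g i + w)) ^+ 2).
    by rewrite sumEFin !lee_fin => -[-> ->].
  apply: eq_bigr => i _; rewrite (fF w Jw); last by rewrite -gE; exists i.
  by congr (normc _ ^+ 2); apply: eq_bigr => j _; rewrite expoDr -expo_natmul mulrA.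
have mfold := measurable_fold Munit mX (measurable_sqr_normc mf) _.
have mE : measurable_fun (J : set L) (fun w : L =>
    \esum_(l in lattice_fiber M Omega w) (normc (f (l + w)%R) ^+ 2)%:E)%E.
  apply: (measurable_funS measurableT (@subsetT _ _)); apply: mfold => x.
  by rewrite lee_fin sqr_ge0.
have ms (c : R) : measurable_fun (J : set L)
    (fun w : L => (c * \sum_(j < k) normc (F j w) ^+ 2)%:E).
  apply/measurable_EFinP; apply: measurable_funM; first exact: measurable_cst.
  by apply: measurable_sum => j; apply/measurable_EFinP; exact: mF2.
have s0 (c : R) (w : L) : 0 < c -> (0 <= (c * \sum_(j < k) normc (F j w) ^+ 2)%:E)%E.
  by move=> c0; rewrite lee_fin; apply: mulr_ge0; [exact: ltW|];
    apply: sumr_ge0 => j _; exact: sqr_ge0.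
have e0 (w : L) : (0 <= \esum_(l in lattice_fiber M Omega w) (normc (f (l + w)%R) ^+ 2)%:E)%E.
  by apply: esum_ge0 => l _; rewrite lee_fin sqr_ge0.
rewrite !sumE//; apply/andP; split; apply: ge0_le_integral => //.
- by move=> w _; exact: s0.
- by move=> w Jw; have /andP[] := point w Jw.
- by move=> w Jw; have /andP[] := point w Jw.
Qed.

Local Notation K := ('I_k * 'cV[R]_d)%type.
Local Notation S := [set p : K | dual_lattice M p.2].
Local Notation u := (fun p : K => expo (a p.1 + p.2) : L -> R[i]).

Let Lsq_full (f : L -> R[i]) : cmeasurable (I : set L) f ->
  Lsq mu (J : set L) f = Lsq mu (I : set L) f.
Proof.
move=> mf; have mIJ : measurable ((I : set L) `\` (J : set L)) by exact: measurableD.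
have := @ge0_negligible_integral _ L R mu I (I `\` J) _ mIJ mI (measurable_sqr_normc mf) _ J0.
rewrite setDD (setIidr JI) => H; apply/esym/H.
by move=> x _; rewrite lee_fin sqr_ge0.
Qed.

Lemma structured_riesz_bounds : exists A B : R, [/\ 0 < A, 0 < B &
  forall (c : K -> R[i]) (F : {fset K}), [set` F] `<=` S ->
   ((A * \sum_(p <- F) normc (c p) ^+ 2)%:E <=
    Lsq mu (Omega : set L) (fun x => \sum_(p <- F) c p * u p x)%R <=
    (B * \sum_(p <- F) normc (c p) ^+ 2)%:E)%E].
Proof.
have [A [B [A0 B0 AB]]] := structured_bounds.
have muI0 := lebesgue_fundamental_domain_gt0 Munit.
have muIoo := lebesgue_fundamental_domain_fin Munit.
have [m mE] : exists m : R, mu (I : set L) = m%:E.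
  by exists (fine (mu (I : set L))); rewrite fineK// ge0_fin_numE// ltW.
have m0 : 0 < m by rewrite -lte_fin -mE.
(* The factor m is the measure of I, the squared norm of each e_h in Parseval's identity. *)
exists (A * m), (B * m); split; rewrite ?mulr_gt0// => c F FS.
pose G j (w : L) := \sum_(p <- F | p.1 == j) c p * expo p.2 w.
have cmI (h : 'cV[R]_d) : cmeasurable (I : set L) (expo h).
  exact: (cmeasurableS measurableT (@subsetT _ _) (cmeasurable_expo h)).
have GE j : G j = (fun w : L => \sum_(h <- [seq p.2 | p <- F & p.1 == j]) c (j, h) * expo h w).
  apply/funext => w; rewrite /G big_map big_filter.
  by apply: eq_bigr => -[i h] /= /eqP ->.
have mG j : cmeasurable (I : set L) (G j).
  rewrite GE; have := @cmeasurable_sum R _ L (I : set L) _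
    [seq p.2 | p <- F & p.1 == j] (fun h (w : L) => c (j, h) * expo h w).
  by apply => h _; exact: cmeasurableZ.
have LG j : Lsq mu (J : set L) (G j) = ((\sum_(p <- F | p.1 == j) normc (c p) ^+ 2) * m)%:E.
  rewrite Lsq_full// GE (@Lsq_trig R d M Munit _ (fun h => c (j, h))).
  - rewrite mE big_map big_filter EFinM; congr ((_)%:E * _)%E.
    by apply: eq_bigr => -[i h] /= /eqP ->.
  - rewrite map_inj_in_uniq ?filter_uniq ?fset_uniq// => -[i h] [i' h'].
    by rewrite !mem_filter/= => /andP[/eqP -> _] /andP[/eqP -> _] ->.
  - by move=> h /mapP[p + ->]; rewrite mem_filter => /andP[_]; exact: FS.
have := AB (fun x => \sum_(p <- F) c p * u p x) G.
rewrite (_ : (\sum_(j < k) Lsq mu (J : set L) (G j))%E =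
    ((\sum_(p <- F) normc (c p) ^+ 2) * m)%:E).
  rewrite -!EFinM -!mulrA ![m * _]mulrC; apply.
  - have := @cmeasurable_sum R _ L (Omega : set L) _ F (fun p (w : L) => c p * u p w).
    apply => p _; apply: cmeasurableZ.
    exact: (cmeasurableS measurableT (@subsetT _ _) (cmeasurable_expo _)).
  - by move=> j; exact: (cmeasurableS mI JI).
  - move=> w _ l [ll _]; rewrite (partition_big (fun p => p.1) xpredT)//=.
    apply: eq_bigr => j _; rewrite /G mulr_sumr big_seq_cond [RHS]big_seq_cond.
    apply: eq_bigr => p /andP[pF /eqP pj]; rewrite pj expoDl (expoDr p.2).
    by rewrite (expo_dual (FS _ pF) ll) mul1r mulrCA.
under eq_bigr do rewrite LG; rewrite sumEFin -mulr_suml; congr (_ * m)%:E.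
by rewrite [RHS](partition_big (fun p => p.1) xpredT).
Qed.

(** For fixed s a measurable set of points w, as a finite intersection of translates of Omega with
    J, or empty when s is not injective. The countably many s together cover J. *)
Let enum_fiber (s : 'I_k -> 'cV[int]_d) (w : 'cV[R]_d) := [/\ J w, injective s &
  forall i, Omega (lattice_point M (s i) + w)].

Let enum_cover w : J w -> exists s : {ffun 'I_k -> 'cV[int]_d}, enum_fiber s w.
Proof.
move=> Jw; have [g [ginj gE _]] := enum Jw.
have gl i : lattice_fiber M Omega w (g i) by rewrite -gE; exists i.
have /choice[s sE] : forall i, exists z, lattice_point M z = g i.
  by move=> i; have [[z _ zE] _] := gl i; exists z.
exists [ffun i => s i]; split=> //.
  by move=> i j; rewrite !ffunE => /(congr1 (lattice_point M)); rewrite !sE => /ginj.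
by move=> i; rewrite ffunE sE; have [] := gl i.
Qed.

Let enum_fiber_separated s w : enum_fiber s w ->
  forall i j, i != j ->
  delta <= normc (expo alpha (lattice_point M (s i)) - expo alpha (lattice_point M (s j))).
Proof.
move=> [Jw sinj sO] i j ij; have [g [ginj gE gd]] := enum Jw.
have sg i' : exists j', g j' = lattice_point M (s i').
  have : lattice_fiber M Omega w (lattice_point M (s i')).
    by split; [exact: lattice_pointP|exact: sO].
  by rewrite -gE => -[j' _ <-]; exists j'.
have [i' i'E] := sg i; have [j' j'E] := sg j; rewrite -i'E -j'E; apply: gd.
apply: contraNneq ij => ij'; apply/eqP/sinj/(lattice_point_inj Munit).
by rewrite -i'E -j'E ij'.
Qed.

(** The fiber has k elements, so k distinct ones exhaust it: comparison with g gives an injective,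
    hence bijective, self-map of 'I_k. *)
Let enum_fiberE s w : enum_fiber s w ->
  lattice_fiber M Omega w = range (fun i => lattice_point M (s i)).
Proof.
move=> [Jw sinj sO]; have [g [ginj gE gd]] := enum Jw.
have lO i : lattice_fiber M Omega w (lattice_point M (s i)).
  by split; [exact: lattice_pointP|exact: sO].
apply/seteqP; split=> [l|_ [i _ <-]]; last exact: lO.
rewrite -gE => -[j _ <-].
have /choice[t tE] : forall i, exists j', g j' = lattice_point M (s i).
  by move=> i; have := lO i; rewrite -gE => -[j' _ <-]; exists j'.
have tinj : injective t.
  move=> i i' /(congr1 g); rewrite !tE => /(lattice_point_inj Munit); exact: sinj.
exists (invF tinj j) => //=.
by rewrite -tE f_invF.
Qed.

Let measurable_enum_fiber s : measurable (enum_fiber s : set L).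
Proof.
have [sinj|ninj] := pselect (injective s); last first.
  by rewrite (_ : enum_fiber s = set0)//; apply/seteqP; split=> // w [].
rewrite (_ : enum_fiber s =
    J `&` \bigcap_(i in [set: 'I_k]) ((fun w => w + lattice_point M (s i)) @^-1` Omega)).
  apply: measurableI => //; apply: fin_bigcap_measurable => [|i _].
    exact: finite_finset.
  exact: lebesgue_measurable_shift.
apply/seteqP; split=> w.
  by move=> [Jw _ sO]; split=> // i _ /=; rewrite addrC.
by move=> [Jw sO]; split=> // i; rewrite addrC; exact: sO.
Qed.

Lemma structured_solution (f : L -> R[i]) : cmeasurable (Omega : set L) f ->
  exists F : 'I_k -> L -> R[i], (forall j, cmeasurable (I : set L) (F j)) /\
    forall w, J w -> structured_eq f (F ^~ w) w.
Proof.
move=> mf.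
pose z (s : {ffun 'I_k -> 'cV[int]_d}) i := expo alpha (lattice_point M (s i)).
have /choice[b bE] : forall s, exists b : 'I_k -> 'I_k -> R[i], injective (z s) ->
    forall i l, \sum_(j < k) z s l ^+ j * b i j = (l == i)%:R.
  move=> s; have [zinj|] := pselect (injective (z s)); last by exists (fun _ _ => 0).
  have /choice[b bE] := fun i => vandermonde_interpolation i zinj.
  by exists b.
have zinj (s : {ffun _}) w : enum_fiber s w -> injective (z s).
  move=> sw i j zij; apply/eqP; apply: contraTT isT => ij.
  have := enum_fiber_separated sw ij; rewrite -/(z s i) -/(z s j) zij subrr.
  by rewrite Normc.normc0 leNgt delta_gt0.
(* Lagrange interpolation of the values of f on the fiber, with the phase e_(a_j)(w) divided out; b
   depends on s only, so this is measurable on [enum_fiber s]. *)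
pose Fs s j (w : L) := expo (- a j) w * \sum_(i < k) b s i j * f (lattice_point M (s i) + w).
have FsE (s : {ffun _}) w : enum_fiber s w -> structured_eq f (Fs s ^~ w) w.
  move=> sw l; rewrite (enum_fiberE sw) => -[i _ <-].
  under eq_bigr do rewrite /Fs expoDr mulrA -(mulrA (expo _ _)) (mulrC (expo (a _) w))
    expoNK mulr1 mulr_sumr.
  rewrite exchange_big/=.
  under eq_bigr do under eq_bigr do rewrite mulrA.
  under eq_bigr do rewrite -mulr_suml.
  under eq_bigr => i' _.
    under eq_bigr do rewrite expo_natmul.
    rewrite (bE s (zinj s w sw)); over.
  rewrite (bigD1 i)//= eqxx mul1r big1 ?addr0// => i' ii'.
  by rewrite eq_sym (negbTE ii') mul0r.
pose sol (w : L) (G : 'I_k -> R[i]) := structured_eq f G w.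
(* The lower Vandermonde bound applied to the difference of two solutions. It identifies the chosen
   solution with the explicit one on each piece. *)
have sol_uniq (s : {ffun _}) w G G' : enum_fiber s w -> sol w G -> sol w G' -> G = G'.
  move=> sw fG fG'; have [A [B [A0 _ AB]]] := vandermonde_bounds k delta_gt0.
  have z1 i : normc (z s i) = 1 by exact: normc_expo.
  have [+ _] := AB (z s) z1 (enum_fiber_separated sw) (fun j => expo (a j) w * (G j - G' j)).
  have zero i : \sum_(j < k) z s i ^+ j * (expo (a j) w * (G j - G' j)) = 0.
    have il : lattice_fiber M Omega w (lattice_point M (s i)).
      by rewrite (enum_fiberE sw); exists i.
    rewrite -[RHS](subrr (f (lattice_point M (s i) + w))) {1}(fG _ il) (fG' _ il) -sumrB.
    by apply: eq_bigr => j _; rewrite -mulrBr expoDr (expo_natmul _ _ (lattice_point _ _)) mulrA.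
  rewrite [X in _ <= X]big1; last by move=> i _; rewrite zero Normc.normc0 expr0n.
  rewrite pmulr_rle0// => s0; apply/funext => j; apply/eqP; rewrite -subr_eq0.
  have : \sum_(j < k) normc (expo (a j) w * (G j - G' j)) ^+ 2 == 0.
    by rewrite eq_le s0 sumr_ge0// => i _; exact: sqr_ge0.
  rewrite psumr_eq0 => [/allP/(_ j)|i _]; last exact: sqr_ge0.
  rewrite mem_index_enum Normc.normcM normc_expo mul1r sqrf_eq0 => /(_ isT)/=.
  by move=> /eqP/Normc.eq0_normc ->.
have /choice[F FE] : forall w, exists G, (J w -> sol w G) /\ (~ J w -> G = fun=> 0).
  move=> w; have [Jw|nJw] := pselect (J w); last by exists (fun=> 0).
  by have [s sw] := enum_cover Jw; exists (Fs s ^~ w); split=> // _; exact: FsE.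
exists (fun j w => F w j); split=> [j|w Jw]; last by have [/(_ Jw)] := FE w.
(* Overlaps and repetitions are harmless: only a countable measurable cover of J is needed for
   gluing. *)
pose piece n : set L := if unpickle n is Some s
  then enum_fiber (s : {ffun 'I_k -> 'cV[int]_d}) else set0.
have JE : (J : set L) = \bigcup_n piece n.
  apply/seteqP; split=> [w Jw|w [n _]]; rewrite /piece.
    by have [s sw] := enum_cover Jw; exists (pickle s) => //; rewrite pickleK.
  by case: (unpickle n) => // s [].
have mFs (s : {ffun _}) : cmeasurable (enum_fiber s : set L) (F ^~ j).
  have mshift i : cmeasurable (enum_fiber s : set L)
      (fun w => f (lattice_point M (s i) + w)).
    pose t : L -> L := fun w => w + lattice_point M (s i).
    have mt : measurable_fun setT t := measurable_fun_shift (lattice_point M (s i)).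
    have mOt : measurable (t @^-1` (Omega : set L)) by rewrite -[X in measurable X]setTI; exact: mt.
    have sub : (enum_fiber s : set L) `<=` t @^-1` (Omega : set L).
      by move=> w [_ _ sO]; rewrite /= /t addrC; exact: sO.
    apply: (cmeasurableS mOt sub).
    rewrite (_ : (fun w : L => _) = f \o t); last by apply/funext => w; rewrite /= /t addrC.
    have img : t @` (t @^-1` (Omega : set L)) `<=` (Omega : set L) by move=> _ [w + <-].
    have mtO : measurable_fun (t @^-1` (Omega : set L)) t.
      exact: (measurable_funS measurableT (@subsetT _ _) mt).
    have [f1 f2] := mf; split; first exact: (measurable_comp mX img f1 mtO).
    exact: (measurable_comp mX img f2 mtO).
  have mFs : cmeasurable (enum_fiber s : set L) (Fs s j).
    apply: cmeasurableM.
      exact: (cmeasurableS measurableT (@subsetT _ _) (cmeasurable_expo _)).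
    have := @cmeasurable_sum R _ L (enum_fiber s : set L) _ (index_enum 'I_k)
      (fun i (w : L) => b s i j * f (lattice_point M (s i) + w)).
    by apply => i _; exact: cmeasurableZ.
  have FFs w : enum_fiber s w -> Fs s j w = F w j.
    move=> sw; have [Jw _ _] := sw.
    have -> : F w = Fs s ^~ w by apply: (sol_uniq s w) => //; [exact: (FE w).1|exact: FsE].
    by [].
  have [f1 f2] := mFs; split.
    by apply: eq_measurable_fun f1 => w /set_mem sw; rewrite FFs.
  by apply: eq_measurable_fun f2 => w /set_mem sw; rewrite FFs.
have mpiece n : measurable (piece n) by rewrite /piece; case: (unpickle n) => [s|].
have mFpiece n : cmeasurable (piece n) (F ^~ j).
  rewrite /piece; case: (unpickle n) => [s|]; first exact: mFs.
  by split; exact: measurable_fun_set0.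
have glue (f0 : L -> R) := (@measurable_fun_bigcup _ _ L R piece f0 mpiece).2.
have [m1 m2] : cmeasurable (J : set L) (F ^~ j).
  by rewrite JE; split; apply: glue => n; have [] := mFpiece n.
have mIJ : measurable ((I : set L) `\` (J : set L)) by exact: measurableD.
have [n1 n2] : cmeasurable ((I : set L) `\` (J : set L)) (F ^~ j).
  have F0 (w : L) : ((I : set L) `\` (J : set L)) w -> F w j = 0.
    by move=> [_ /((FE w).2) ->].
  have [c1 c2] := @cmeasurable_cst R _ L ((I : set L) `\` (J : set L)) 0; split.
    by apply: eq_measurable_fun c1 => w /set_mem/F0 ->.
  by apply: eq_measurable_fun c2 => w /set_mem/F0 ->.
have <- : (J : set L) `|` ((I : set L) `\` (J : set L)) = I by rewrite setDUK.
by split; apply/measurable_funU.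
Qed.

Let me_ (X : set L) (p : K) : cmeasurable X (u p).
Proof. exact: (cmeasurableS measurableT (@subsetT _ _) (cmeasurable_expo _)). Qed.

Lemma structured_complete (f : L -> R[i]) : cmeasurable (Omega : set L) f ->
  (Lsq mu (Omega : set L) f < +oo)%E -> L2_closure mu (Omega : set L) S u f.
Proof.
move=> mf foo; have [A [B [A0 B0 AB]]] := structured_bounds.
have [F [mF fF]] := structured_solution mf.
have mFJ j := cmeasurableS mI JI (mF j).
have /andP[Ff _] := AB f F mf mFJ fF.
have Foo j : (Lsq mu (I : set L) (F j) < +oo)%E.
  rewrite -Lsq_full//; apply: (@le_lt_trans _ _ (\sum_(i < k) Lsq mu (J : set L) (F i))%E).
    by rewrite (bigD1 j)//= leeDl// sume_ge0// => i _; exact: Lsq_ge0.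
  have := le_lt_trans Ff foo; case: (\sum_(i < k) _)%E => [r _| |//]; first by rewrite ltry.
  by rewrite mulry gtr0_sg// mul1e.
(* The k errors, multiplied by B, add up to e k / (k + 1), which stays strictly below e. *)
move=> e e0; have ek : 0 < e / (B * k.+1%:R) by rewrite divr_gt0// mulr_gt0.
have approx j : exists P, span (dual_lattice M) (fun h => expo h : L -> R[i]) P /\
    (Lsq mu (I : set L) (fun w => F j w - P w)%R < (e / (B * k.+1%:R))%:E)%E.
  by have [P sP FP] := trig_dense Munit (mF j) (Foo j) ek; exists P.
have [P sP] := choice approx.
have mP j : cmeasurable (setT : set L) (P j).
  have [sPj _] := sP j.
  exact: (cmeasurable_span (fun h _ => cmeasurable_expo h) sPj).
have mPI j : cmeasurable (I : set L) (P j) by exact: cmeasurableS (mP j).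
exists (fun x : L => \sum_(j < k) expo (a j) x * P j x).
  apply: span_sum => j _; have [[s sS ->] _] := sP j.
  exists [seq (b.1, (j, b.2)) | b <- s]; first by move=> _ /mapP[b /sS bS ->].
  apply/funext => x; rewrite big_map mulr_sumr; apply: eq_bigr => b _ /=.
  by rewrite expoDl mulrCA.
have mp : cmeasurable (Omega : set L) (fun x : L => \sum_(j < k) expo (a j) x * P j x).
  have := @cmeasurable_sum R _ L (Omega : set L) _ (index_enum 'I_k)
    (fun j (x : L) => expo (a j) x * P j x).
  apply => j _; apply: cmeasurableM; last exact: (cmeasurableS measurableT).
  exact: (cmeasurableS measurableT (@subsetT _ _) (cmeasurable_expo _)).
have := AB (fun x => f x - \sum_(j < k) expo (a j) x * P j x) (fun j w => F j w - P j w)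
  (cmeasurableB mf mp) (fun j => cmeasurableB (mFJ j) (cmeasurableS mI JI (mPI j))).
(* Each P_j has frequencies in the dual lattice, so its values at l + w and at w agree and the error
   satisfies the structured equation. *)
move=> /(_ _)/wrap[w Jw l lw|/andP[_ /le_lt_trans]].
  rewrite (fF w Jw l lw) -sumrB; apply: eq_bigr => j _; rewrite mulrBr.
  congr (_ - _ * _); have [ll _] := lw; have [[s sS ->] _] := sP j.
  rewrite !big_seq; apply: eq_bigr => b bs.
  by rewrite expoDr (expo_dual (sS _ bs) ll) mul1r.
apply.
apply: (@le_lt_trans _ _ (B%:E * \sum_(j < k) (e / (B * k.+1%:R))%:E)%E).
  rewrite lee_pmul2l//; apply: lee_sum => j _.
  rewrite Lsq_full; last exact: cmeasurableB.
  by have [_ /ltW] := sP j.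
rewrite sumEFin -EFinM lte_fin sumr_const card_ord -(mulr_natl _ k).
have n0 : k.+1%:R != 0 :> R by rewrite pnatr_eq0.
rewrite (_ : B * (_ * _) = e * (k%:R / k.+1%:R)).
  by rewrite -[ltRHS]mulr1 ltr_pM2l// ltr_pdivrMr// mul1r ltr_nat.
by move: (k.+1%:R) n0 => n n0; field; rewrite n0 gt_eqF.
Qed.

Lemma structured_in_L2 p : S p -> in_L2 Omega (u p).
Proof.
move=> Sp; have [A [B [A0 B0 AB]]] := structured_riesz_bounds.
have [m1 m2] := me_ (Omega : set L) p; split=> //.
have FS : [set` [fset p]%fset] `<=` S by move=> q /=; rewrite inE => /eqP ->.
(* The upper bound for a one-element family gives the finite norm. *)
have /andP[_] := AB (fun=> 1) _ FS.
rewrite (_ : (fun x => _) = u p).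
  by move=> /le_lt_trans; apply; rewrite ltry.
by apply/funext => x; rewrite big_seq_fset1 mul1r.
Qed.

End structured.

Section span_fsets.
Context {R : realType} {T : Type} {K : choiceType} (S : set K) (u : K -> T -> R[i]).

Lemma span_fsets p : span S u p -> exists (F : set K) (c : K -> R[i]),
  fsets S F /\ p = (fun x => \sum_(s \in F) c s * u s x).
Proof.
move=> [s sS ->]; pose F := undup [seq b.2 | b <- s].
exists [set` F], (fun h => \sum_(b <- s | b.2 == h) b.1); split.
  split; first exact: finite_seq.
  by move=> h /=; rewrite mem_undup => /mapP[b /sS bS ->].
apply/funext => x; rewrite -fsbig_seq ?undup_uniq//.
under [RHS]eq_bigr do rewrite mulr_suml.
rewrite (exchange_big_dep xpredT)//= big_seq [RHS]big_seq; apply: eq_bigr => b bs.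
rewrite -big_filter (_ : [seq h <- F | b.2 == h] = [:: b.2]) ?big_seq1//.
have bF : b.2 \in F by rewrite mem_undup; apply/mapP; exists b.
rewrite (eq_filter (a2 := pred1 b.2)); last by move=> h /=; rewrite eq_sym.
by rewrite filter_pred1_uniq// undup_uniq.
Qed.

End span_fsets.

(** * Lexicographic listings *)

Section lex.
Context {R : realType} {d : nat}.
Implicit Types x y : 'cV[R]_d.

Lemma lex_lt_irr x : ~ lex_lt x x.
Proof. by move=> [i []]; rewrite ltxx. Qed.

Lemma lex_lt_trans y x z : lex_lt x y -> lex_lt y z -> lex_lt x z.
Proof.
move=> [i [xyi xy]] [j [yzj yz]]; have [ij|ji|ij] := ltngtP i j.
- exists i; split; last by rewrite -(yzj i ij).
  by move=> l li; rewrite xyi// yzj// (ltn_trans li).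
- exists j; split; last by rewrite (xyi j ji).
  by move=> l lj; rewrite xyi ?yzj// (ltn_trans lj).
- have {}ij : i = j by exact: val_inj.
  subst j; exists i; split; last exact: lt_trans yz.
  by move=> l li; rewrite xyi// yzj.
Qed.

Lemma lex_lt_total x y : x <> y -> lex_lt x y \/ lex_lt y x.
Proof.
move=> xy; have [i0 xyi0] : exists i, x i ord0 != y i ord0.
  apply: contrapT => xyE; apply: xy; apply/matrixP => i j; rewrite ord1.
  by apply/eqP; apply: contrapT => /negP xyi; apply: xyE; exists i.
case: (@arg_minnP _ i0 (fun i => x i ord0 != y i ord0) (@nat_of_ord d) xyi0) => i xyi imin.
have eqxy (j : 'I_d) : (j < i)%N -> x j ord0 = y j ord0.
  by move=> ji; apply/eqP; apply: contraTT ji => /imin; rewrite -leqNgt.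
have := lt_total xyi => /orP[xyl|yxl]; [left|right]; exists i; split=> // j /eqxy.
by [].
Qed.

(** Separation is assumed only for listings, so their existence is what makes it speak of every
    fiber over J. The list comes from sorting by the reflexive closure of [lex_lt]. *)
Lemma lex_listing_exists (k : nat) (A : set 'cV[R]_d) : (A #= `I_k)%card ->
  exists g : 'I_k -> 'cV[R]_d, lex_listing A g.
Proof.
move=> Ak; have finA : finite_set A by exists k.
pose r : rel 'cV[R]_d := fun x y => `[< x = y \/ lex_lt x y >].
have rT : total r.
  move=> x y; apply/orP; have [->|/lex_lt_total[]] := pselect (x = y).
  - by left; apply/asboolP; left.
  - by left; apply/asboolP; right.
  - by right; apply/asboolP; right.
have rtr : transitive r.
  move=> y x z /asboolP[->//|xy] /asboolP[<-|yz]; apply/asboolP; right => //.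
  exact: lex_lt_trans yz.
pose s := sort r (fset_set A).
have us : uniq s by rewrite sort_uniq fset_uniq.
have ss : size s = k.
  rewrite size_sort; apply/eqP; have := card_fset_set Ak.
  by move=> ->.
have sA x : (x \in s) = (x \in A) by rewrite mem_sort in_fset_set.
exists (fun i => nth 0 s i); split.
  apply/seteqP; split=> [_ [i _ <-]|x Ax].
    by apply/set_mem; rewrite -sA mem_nth ?ss.
  have xs : x \in s by rewrite sA; exact: mem_set.
  have ix : (index x s < k)%N by rewrite -ss index_mem.
  by exists (Ordinal ix) => //=; rewrite nth_index.
move=> j l jl.
have /asboolP[e|//] : r (nth 0 s j) (nth 0 s l).
  by apply: (sorted_ltn_nth rtr) => //; rewrite ?inE ?ss//; exact: sort_sorted.
by move/eqP: e; rewrite nth_uniq ?ss// => /eqP e; rewrite e ltnn in jl.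
Qed.

Lemma lex_listing_inj (k : nat) (A : set 'cV[R]_d) (g : 'I_k -> 'cV[R]_d) :
  lex_listing A g -> injective g.
Proof.
move=> [_ glt] i j gij; have [ij|ji|/val_inj//] := ltngtP i j.
- by have := glt _ _ ij; rewrite gij => /lex_lt_irr.
- by have := glt _ _ ji; rewrite gij => /lex_lt_irr.
Qed.

End lex.

Theorem theorem4p5 (R : realType) (d k : nat) (M : 'M[R]_d)
    (Omega : set 'cV[R]_d) :
  (1 <= k)%N ->
  M \in unitmx ->
  lebesgue_measurable Omega ->
  k_tiles k M Omega ->
  (forall w, fundamental_domain M w ->
    (lattice_fiber M Omega w #= `I_k)%card) ->
  (exists (alpha : 'cV[R]_d) (delta : R) (J : set 'cV[R]_d),
    [/\ 0 < delta,
        full_measure_subset J (fundamental_domain M) &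
        exp_separated alpha delta (fiber_vectors k M Omega J)]) ->
  structured_riesz_basis k M Omega.
Proof.
move=> _ Munit mO _ fiberk [alpha [delta [J [delta0 [mJ JI J0] sep]]]].
have enum w : J w -> exists g : 'I_k -> 'cV[R]_d,
    [/\ injective g, range g = lattice_fiber M Omega w &
     forall i j, i != j -> delta <= normc (expo alpha (g i) - expo alpha (g j))].
  move=> Jw; have [g gl] := lex_listing_exists (fiberk w (JI w Jw)).
  exists g; split; [exact: lex_listing_inj gl|by have [] := gl|].
  by apply: sep; exists w.
exists (fun j : 'I_k => alpha *+ j); split.
- move=> p Sp; exact: (structured_in_L2 Munit mO mJ JI J0 delta0 enum Sp).
- move=> f [f1 f2 foo] eps eps0.
  have := structured_complete Munit mO mJ JI J0 delta0 enum (conj f1 f2) foo.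
  (* [L2_closure] bounds the squared norm of the error by its parameter, hence eps^2. *)
  move=> /(_ (eps ^+ 2) (exprn_gt0 2 eps0))[p /span_fsets[F [c [FS ->]]] fp].
  by exists F, c; split.
have [A [B [A0 B0 AB]]] := structured_riesz_bounds Munit mO mJ JI J0 delta0 enum.
exists (A / 2), (2 * B); split; rewrite ?divr_gt0 ?mulr_gt0// => c coo.
have me_ (p : 'I_k * 'cV[R]_d) : dual_lattice M p.2 -> cmeasurable
    (Omega : set (lebesgue_space R d)) (expo (alpha *+ p.1 + p.2)).
  by move=> _; exact: (cmeasurableS measurableT (@subsetT _ _) (cmeasurable_expo _)).
have [E cE] : exists E : R, l2_sqnorm [set p : 'I_k * 'cV[R]_d | dual_lattice M p.2] c = E%:E.
  exists (fine (l2_sqnorm [set p : 'I_k * 'cV[R]_d | dual_lattice M p.2] c)).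
  by rewrite fineK// ge0_fin_numE// esum_ge0// => p _; rewrite lee_fin sqr_ge0.
have [g [[g1 g2] goo gsum glb gub]] := riesz_sum mO A0 B0 me_ AB cE.
by exists g; split=> //; rewrite cE -EFinM.
Qed.
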